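(* Let $A$ be a left proper dg algebra over $k$ and let $e\in H_0(A)$ be an idempotent which is represented in $A$ by a $0$-cycle (also denoted $e$) that is a strict idempotent. Let $A_e:=A\langle h\rangle/(he=eh=h)$ be the dg algebra obtained by freely adjoining to $A$ a generator $h$ of homological degree $1$ and quotienting by the relations $he=h$ and $eh=h$, with differential extending that of $A$ and $d(h)=e$. Then $A_e$ is quasi-isomorphic, as a dg algebra, to the derived quotient $A/^{\mathbb{L}}AeA$.
   Context: $k$ is a fixed unital commutative ring. A dg algebra is a unital associative differential $\mathbb{Z}$-graded (homologically graded) $k$-algebra; dg algebras carry the model structure with weak equivalences the quasi-isomorphisms and fibrations the surjections. A dg algebra $A$ is left proper if for any cofibrant replacement $P\to A$ (surjective quasi-isomorphism from a cofibrant $P$) and any cofibration $P\rightarrowtail X$, the map $X\to A\ast_PX$ into the pushout is a quasi-isomorphism. For a dg algebra $A$ with cofibrant replacement $Q\to A$, the derived under category of $A$ is the homotopy category of the under category $Q\downarrow\mathrm{dgAlg}$. For $x\in H(A)$, an object $B$ of the derived under category is $x$-killing if the image of $x$ in $H(B)$ is zero. For an idempotent $e\in H_0(A)$, the derived quotient $A/^{\mathbb{L}}AeA$ is the initial object in the full subcategory of $e$-killing dg algebras of the derived under category of $A$ (it exists and is unique up to homotopy). *)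

(* Defs.v *)
From HB Require Import structures.
From mathcomp Require Import all_boot all_order all_algebra.
From mathcomp Require Import generic_quotient.
From mathcomp Require Import boolp zify.

Set Implicit Arguments.
Unset Strict Implicit.
Unset Printing Implicit Defensive.

Import GRing.Theory.
Local Open Scope ring_scope.
Local Open Scope quotient_scope.

(* Graded objects are families indexed by [int].  The product and the
   differential take the relation between the degrees as an argument, so that
   associativity, the Leibniz rule, etc. can be stated without transporting
   along equalities of degrees; these equality proofs are irrelevant since
   [int] is an eqType ([eq_irrelevance]). *)

(* [lmodType] and [comPzRingType] allow zero modules and zero rings, so the
   zero algebra is a [galg] and a [dgAlg]. *)
Record galg (k : comPzRingType) := GAlg {
  gmod :> int -> lmodType k;
  gmul : forall i j l : int, i + j = l -> gmod i -> gmod j -> gmod l;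
  gone : gmod 0;
  gmulDl : forall (i j l : int) (E : i + j = l) a b c,
    gmul E (a + b) c = gmul E a c + gmul E b c;
  gmulDr : forall (i j l : int) (E : i + j = l) a b c,
    gmul E a (b + c) = gmul E a b + gmul E a c;
  gmulZl : forall (i j l : int) (E : i + j = l) (r : k) a b,
    gmul E (r *: a) b = r *: gmul E a b;
  gmulZr : forall (i j l : int) (E : i + j = l) (r : k) a b,
    gmul E a (r *: b) = r *: gmul E a b;
  gmulA : forall (i j m ij jm l : int) (E1 : i + j = ij) (E2 : ij + m = l)
      (E3 : j + m = jm) (E4 : i + jm = l) a b c,
    gmul E2 (gmul E1 a b) c = gmul E4 a (gmul E3 b c);
  gmul1l : forall (i : int) (E : 0 + i = i) a, gmul E gone a = a;
  gmul1r : forall (i : int) (E : i + 0 = i) a, gmul E a gone = a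
}.

Arguments gmul {k g i j l} E a b.
Arguments gone {k} g.

Definition strict_idempotent (k : comPzRingType) (A : galg k) (e : A 0) : Prop :=
  gmul (addr0 0) e e = e.

Definition koszul (k : comPzRingType) (i : int) : k := (-1) ^+ `|i|%N.

Arguments koszul k i : clear implicits.

Record dgAlg (k : comPzRingType) := DGAlg {
  dg_galg :> galg k;
  dg_d : forall n m : int, m + 1 = n -> {linear dg_galg n -> dg_galg m};
  dg_dd : forall (n m p : int) (E : m + 1 = n) (F : p + 1 = m) a,
    dg_d F (dg_d E a) = 0;
  dg_leibniz : forall (i i' j j' l l' : int) (Ei : i' + 1 = i) (Ej : j' + 1 = j)
      (El : l' + 1 = l) (E : i + j = l) (E1 : i' + j = l') (E2 : i + j' = l')
      (a : dg_galg i) (b : dg_galg j),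
    dg_d El (gmul E a b)
      = gmul E1 (dg_d Ei a) b + koszul k i *: gmul E2 a (dg_d Ej b)
}.

Arguments dg_d {k} d {n m} E.

Record dgHom (k : comPzRingType) (A B : dgAlg k) := DGHom {
  hmap :> forall n : int, {linear A n -> B n};
  hmap_d : forall (n m : int) (E : m + 1 = n) a,
    hmap m (dg_d A E a) = dg_d B E (hmap n a);
  hmap_mul : forall (i j l : int) (E : i + j = l) a b,
    hmap l (gmul E a b) = gmul E (hmap i a) (hmap j b);
  hmap_one : hmap 0 (gone A) = gone B
}.

Section Category.
Variable k : comPzRingType.
Implicit Types A B C : dgAlg k.

Definition heq A B (f g : dgHom A B) : Prop := forall n, f n =1 g n.

Definition hid A : dgHom A A :=
  @DGHom k A A (fun n => idfun : {linear A n -> A n})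
    (fun _ _ _ _ => erefl) (fun _ _ _ _ _ _ => erefl) erefl.

Lemma hcomp_d A B C (g : dgHom B C) (f : dgHom A B) n m (E : m + 1 = n) a :
  (g m \o f m) (dg_d A E a) = dg_d C E ((g n \o f n) a).
Proof. by rewrite /= !hmap_d. Qed.

Lemma hcomp_mul A B C (g : dgHom B C) (f : dgHom A B) i j l (E : i + j = l)
    a b :
  (g l \o f l) (gmul E a b) = gmul E ((g i \o f i) a) ((g j \o f j) b).
Proof. by rewrite /= !hmap_mul. Qed.

Lemma hcomp_one A B C (g : dgHom B C) (f : dgHom A B) :
  (g 0 \o f 0) (gone A) = gone C.
Proof. by rewrite /= !hmap_one. Qed.

Definition hcomp A B C (g : dgHom B C) (f : dgHom A B) : dgHom A C :=
  @DGHom k A C (fun n => g n \o f n : {linear A n -> C n})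
    (hcomp_d g f) (hcomp_mul g f) (hcomp_one g f).

End Category.

Section Model.
Variable k : comPzRingType.
Implicit Types A B C P Q X Y : dgAlg k.

Definition is_cycle A n (a : A n) : Prop :=
  forall (m : int) (E : m + 1 = n), dg_d A E a = 0.

Definition is_boundary A n (a : A n) : Prop :=
  exists b : A (n + 1), a = dg_d A (erefl (n + 1)) b.

(* Equality of homology classes; [H_n A] is the setoid of [n]-cycles modulo
   [homologous]. *)
Definition homologous A n (a b : A n) : Prop := is_boundary (a - b).

(* [H_n f] is bijective for every [n]. *)
Definition quasi_iso A B (f : dgHom A B) : Prop :=
  forall n : int,
    (forall a b : A n, is_cycle a -> is_cycle b ->
       homologous (f n a) (f n b) -> homologous a b) /\
    (forall c : B n, is_cycle c -> exists2 a : A n, is_cycle a & homologous (f n a) c).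

Inductive quasi_isomorphic : dgAlg k -> dgAlg k -> Prop :=
| qi_step A B (f : dgHom A B) : quasi_iso f -> quasi_isomorphic A B
| qi_refl A : quasi_isomorphic A A
| qi_sym A B : quasi_isomorphic A B -> quasi_isomorphic B A
| qi_trans A B C :
    quasi_isomorphic A B -> quasi_isomorphic B C -> quasi_isomorphic A C.

Definition fibration A B (f : dgHom A B) : Prop :=
  forall n (b : B n), exists a : A n, f n a = b.

Definition cofibration P X (i : dgHom P X) : Prop :=
  forall B C (p : dgHom B C), fibration p -> quasi_iso p ->
  forall (u : dgHom P B) (v : dgHom X C), heq (hcomp p u) (hcomp v i) ->
  exists h : dgHom X B, heq (hcomp h i) u /\ heq (hcomp p h) v.

(* The left lifting property of the map from the initial dg algebra [k] to
   [P]: the maps out of [k] being unique, they do not appear. *)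
Definition cofibrant P : Prop :=
  forall B C (p : dgHom B C), fibration p -> quasi_iso p ->
  forall v : dgHom P C, exists h : dgHom P B, heq (hcomp p h) v.

Definition cofibrant_replacement P A (p : dgHom P A) : Prop :=
  [/\ cofibrant P, fibration p & quasi_iso p].

Definition is_pushout P A X Y (p : dgHom P A) (i : dgHom P X)
    (l : dgHom A Y) (r : dgHom X Y) : Prop :=
  heq (hcomp l p) (hcomp r i) /\
  forall C (f : dgHom A C) (g : dgHom X C), heq (hcomp f p) (hcomp g i) ->
    exists h : dgHom Y C,
      [/\ heq (hcomp h l) f, heq (hcomp h r) g &
          forall h' : dgHom Y C,
            heq (hcomp h' l) f -> heq (hcomp h' r) g -> heq h' h].

Definition left_proper A : Prop :=
  forall P (p : dgHom P A), cofibrant_replacement p ->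
  forall X (i : dgHom P X), cofibration i ->
  forall Y (l : dgHom A Y) (r : dgHom X Y), is_pushout p i l r -> quasi_iso r.

End Model.

Record underAlg (k : comPzRingType) (Q : dgAlg k) := Under {
  ua_alg :> dgAlg k;
  ua_map : dgHom Q ua_alg
}.

Section Derived.
Variables (k : comPzRingType) (Q : dgAlg k).
Implicit Types X Y Z : underAlg Q.

Record underHom X Y := UnderHom {
  under_hom :> dgHom X Y;
  under_homE : heq (hcomp under_hom (ua_map X)) (ua_map Y)
}.

(* The homotopy category of [underAlg Q] is its (Gabriel-Zisman) localisation at
   the quasi-isomorphisms: a morphism is a zigzag of arrows of [underAlg Q] in
   which the backward ones are quasi-isomorphisms, modulo the congruence
   generated by composition and identities in [underAlg Q] and by the cancellation
   of a quasi-isomorphism with its formal inverse. *)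
Inductive zigzag : underAlg Q -> underAlg Q -> Type :=
| zz_nil X : zigzag X X
| zz_fwd X Y Z (f : underHom X Y) (p : zigzag Y Z) : zigzag X Z
| zz_bwd X Y Z (w : underHom Y X) (qw : quasi_iso w) (p : zigzag Y Z) :
    zigzag X Z.

Inductive zz_eq : forall X Y, zigzag X Y -> zigzag X Y -> Prop :=
| zz_refl X Y (p : zigzag X Y) : zz_eq p p
| zz_sym X Y (p q : zigzag X Y) : zz_eq p q -> zz_eq q p
| zz_trans X Y (p q r : zigzag X Y) : zz_eq p q -> zz_eq q r -> zz_eq p r
| zz_fwd_congr X Y Z (f : underHom X Y) (p q : zigzag Y Z) :
    zz_eq p q -> zz_eq (zz_fwd f p) (zz_fwd f q)
| zz_bwd_congr X Y Z (w : underHom Y X) (qw : quasi_iso w) (p q : zigzag Y Z) :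
    zz_eq p q -> zz_eq (zz_bwd qw p) (zz_bwd qw q)
| zz_id X Y (f : underHom X X) (p : zigzag X Y) :
    heq f (hid X) -> zz_eq (zz_fwd f p) p
| zz_comp X Y Z T (f : underHom X Y) (g : underHom Y Z) (h : underHom X Z)
    (p : zigzag Z T) :
    heq h (hcomp g f) -> zz_eq (zz_fwd f (zz_fwd g p)) (zz_fwd h p)
| zz_fwd_bwd X Y Z (w : underHom X Y) (qw : quasi_iso w) (p : zigzag X Z) :
    zz_eq (zz_fwd w (zz_bwd qw p)) p
| zz_bwd_fwd X Y Z (w : underHom Y X) (qw : quasi_iso w) (p : zigzag X Z) :
    zz_eq (zz_bwd qw (zz_fwd w p)) p.

(* The class of the cycle [x] of [A] is transported to [H(B)] along
   [H(A) <- H(Q) -> H(B)], the first map being an isomorphism when [q] is a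
   cofibrant replacement. *)
Definition killing (A : dgAlg k) (q : dgHom Q A) n (x : A n) (B : underAlg Q) :
    Prop :=
  forall z : Q n, is_cycle z -> homologous (q n z) x -> is_boundary (ua_map B n z).

(* [D] is initial in the full subcategory, of the homotopy category of
   [underAlg Q], of the [e]-killing objects. *)
Definition is_derived_quotient (A : dgAlg k) (q : dgHom Q A) (e : A 0)
    (D : underAlg Q) : Prop :=
  killing q e D /\
  forall B : underAlg Q, killing q e B ->
    exists p : zigzag D B, forall p' : zigzag D B, zz_eq p' p.

End Derived.

(* [adj_galg e] is the graded algebra [A<h>/(he = eh = h)], with [h] of degree
   1, presented by generators and relations: homogeneous formal expressions in
   [h] and the elements of [A] modulo the least congruence that makes them a
   graded algebra under [A] in which [he = eh = h]. *)
Section Adjunction.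
Variables (k : comPzRingType) (A : galg k) (e : A 0).

Inductive adj_term : int -> Type :=
| At_in n (a : A n) : adj_term n
| At_h : adj_term 1
| At_add n (t u : adj_term n) : adj_term n
| At_scale n (r : k) (t : adj_term n) : adj_term n
| At_mul (i j l : int) (E : i + j = l) (t : adj_term i) (u : adj_term j) : adj_term l.

Inductive adj_eq : forall n, adj_term n -> adj_term n -> Prop :=
| ae_refl n (t : adj_term n) : adj_eq t t
| ae_sym n (t u : adj_term n) : adj_eq t u -> adj_eq u t
| ae_trans n (t u v : adj_term n) : adj_eq t u -> adj_eq u v -> adj_eq t v
| ae_add n (t t' u u' : adj_term n) :
    adj_eq t t' -> adj_eq u u' -> adj_eq (At_add t u) (At_add t' u')
| ae_scale n r (t t' : adj_term n) :
    adj_eq t t' -> adj_eq (At_scale r t) (At_scale r t')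
| ae_mul (i j l : int) (E : i + j = l) (t t' : adj_term i) (u u' : adj_term j) :
    adj_eq t t' -> adj_eq u u' -> adj_eq (At_mul E t u) (At_mul E t' u')
| ae_addA n (t u v : adj_term n) :
    adj_eq (At_add t (At_add u v)) (At_add (At_add t u) v)
| ae_addC n (t u : adj_term n) : adj_eq (At_add t u) (At_add u t)
| ae_add0 n (t : adj_term n) : adj_eq (At_add (At_in 0) t) t
| ae_addN n (t : adj_term n) : adj_eq (At_add (At_scale (-1) t) t) (At_in 0)
| ae_scaleA n r s (t : adj_term n) :
    adj_eq (At_scale r (At_scale s t)) (At_scale (r * s) t)
| ae_scale1 n (t : adj_term n) : adj_eq (At_scale 1 t) t
| ae_scaleDr n r (t u : adj_term n) :
    adj_eq (At_scale r (At_add t u)) (At_add (At_scale r t) (At_scale r u))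
| ae_scaleDl n r s (t : adj_term n) :
    adj_eq (At_scale (r + s) t) (At_add (At_scale r t) (At_scale s t))
| ae_mulDl (i j l : int) (E : i + j = l) t t' u :
    adj_eq (At_mul E (At_add t t') u) (At_add (At_mul E t u) (At_mul E t' u))
| ae_mulDr (i j l : int) (E : i + j = l) t u u' :
    adj_eq (At_mul E t (At_add u u')) (At_add (At_mul E t u) (At_mul E t u'))
| ae_mulZl (i j l : int) (E : i + j = l) r t u :
    adj_eq (At_mul E (At_scale r t) u) (At_scale r (At_mul E t u))
| ae_mulZr (i j l : int) (E : i + j = l) r t u :
    adj_eq (At_mul E t (At_scale r u)) (At_scale r (At_mul E t u))
| ae_mulA (i j m ij jm l : int) (E1 : i + j = ij) (E2 : ij + m = l)
      (E3 : j + m = jm) (E4 : i + jm = l) t u v :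
    adj_eq (At_mul E2 (At_mul E1 t u) v) (At_mul E4 t (At_mul E3 u v))
| ae_mul1l (n : int) (E : 0 + n = n) t : adj_eq (At_mul E (At_in (gone A)) t) t
| ae_mul1r (n : int) (E : n + 0 = n) t : adj_eq (At_mul E t (At_in (gone A))) t
| ae_inD n (a b : A n) : adj_eq (At_in (a + b)) (At_add (At_in a) (At_in b))
| ae_inZ n r (a : A n) : adj_eq (At_in (r *: a)) (At_scale r (At_in a))
| ae_inM (i j l : int) (E : i + j = l) (a : A i) (b : A j) :
    adj_eq (At_in (gmul E a b)) (At_mul E (At_in a) (At_in b))
| ae_he (E : 1 + 0 = 1 :> int) : adj_eq (At_mul E At_h (At_in e)) At_h
| ae_eh (E : 0 + 1 = 1 :> int) : adj_eq (At_mul E (At_in e) At_h) At_h.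

Section Quotient.
Variable n : int.

HB.instance Definition _ := gen_eqMixin (adj_term n).
HB.instance Definition _ := gen_choiceMixin (adj_term n).

Definition adj_rel (t u : adj_term n) : bool := `[< adj_eq t u >].

Lemma adj_rel_refl : reflexive adj_rel.
Proof. by move=> t; apply/asboolP; apply: ae_refl. Qed.

Lemma adj_rel_sym : symmetric adj_rel.
Proof. by move=> t u; apply/asboolP/asboolP; apply: ae_sym. Qed.

Lemma adj_rel_trans : transitive adj_rel.
Proof.
by move=> u t v /asboolP tu /asboolP uv; apply/asboolP; apply: ae_trans tu uv.
Qed.

Canonical adj_equiv :=
  EquivRel adj_rel adj_rel_refl adj_rel_sym adj_rel_trans.

Definition adj : Type := {eq_quot adj_equiv}.
HB.instance Definition _ := Choice.on adj.
HB.instance Definition _ := EqQuotient.on adj.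

Definition adj_cls (t : adj_term n) : adj := \pi_adj t.

Lemma adj_clsE t u : adj_cls t = adj_cls u <-> adj_eq t u.
Proof. by split=> [/eqmodP/asboolP|tu]; [|apply/eqmodP/asboolP]. Qed.

Lemma adj_clsK (x : adj) : adj_cls (repr x) = x.
Proof. exact: reprK. Qed.

Lemma adj_ind (P : adj -> Prop) : (forall t, P (adj_cls t)) -> forall x, P x.
Proof. by move=> Pt x; rewrite -(adj_clsK x). Qed.

Lemma adj_reprE t : adj_eq (repr (adj_cls t)) t.
Proof. by apply/adj_clsE; rewrite adj_clsK. Qed.

Definition adj_add (x y : adj) := adj_cls (At_add (repr x) (repr y)).
Definition adj_scale (r : k) (x : adj) := adj_cls (At_scale r (repr x)).

Lemma adj_addE t u : adj_add (adj_cls t) (adj_cls u) = adj_cls (At_add t u).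
Proof. by apply/adj_clsE/ae_add; apply: adj_reprE. Qed.

Lemma adj_scaleE r t : adj_scale r (adj_cls t) = adj_cls (At_scale r t).
Proof. by apply/adj_clsE/ae_scale/adj_reprE. Qed.

Lemma adj_addA : associative adj_add.
Proof.
elim/adj_ind=> t; elim/adj_ind=> u; elim/adj_ind=> v.
by rewrite !adj_addE; apply/adj_clsE/ae_addA.
Qed.

Lemma adj_addC : commutative adj_add.
Proof.
elim/adj_ind=> t; elim/adj_ind=> u.
by rewrite !adj_addE; apply/adj_clsE/ae_addC.
Qed.

Lemma adj_add0 : left_id (adj_cls (At_in 0)) adj_add.
Proof. by elim/adj_ind=> t; rewrite !adj_addE; apply/adj_clsE/ae_add0. Qed.

Lemma adj_addN : left_inverse (adj_cls (At_in 0)) (adj_scale (-1)) adj_add.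
Proof.
by elim/adj_ind=> t; rewrite adj_scaleE adj_addE; apply/adj_clsE/ae_addN.
Qed.

HB.instance Definition _ :=
  GRing.isZmodule.Build adj adj_addA adj_addC adj_add0 adj_addN.

Lemma adj_cls_add t u : adj_cls (At_add t u) = adj_cls t + adj_cls u.
Proof. by rewrite -adj_addE. Qed.

Lemma adj_scaleA r s x : adj_scale r (adj_scale s x) = adj_scale (r * s) x.
Proof.
by elim/adj_ind: x => t; rewrite !adj_scaleE; apply/adj_clsE/ae_scaleA.
Qed.

Lemma adj_scale1 : left_id 1 adj_scale.
Proof. by elim/adj_ind=> t; rewrite adj_scaleE; apply/adj_clsE/ae_scale1. Qed.

Lemma adj_scaleDr : right_distributive adj_scale +%R.
Proof.
move=> r; elim/adj_ind=> t; elim/adj_ind=> u.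
by rewrite -adj_cls_add !adj_scaleE -adj_cls_add; apply/adj_clsE/ae_scaleDr.
Qed.

Lemma adj_scaleDl x : {morph adj_scale^~ x : r s / r + s}.
Proof.
elim/adj_ind: x => t r s.
by rewrite !adj_scaleE -adj_cls_add; apply/adj_clsE/ae_scaleDl.
Qed.

HB.instance Definition _ :=
  GRing.Zmodule_isLmodule.Build k adj
    adj_scaleA adj_scale1 adj_scaleDr adj_scaleDl.

End Quotient.

Lemma adj_cls_scale n r (t : adj_term n) :
  adj_cls (At_scale r t) = r *: adj_cls t.
Proof. by rewrite -adj_scaleE. Qed.

Definition adj_mul i j l (E : i + j = l) (x : adj i) (y : adj j) : adj l :=
  adj_cls (At_mul E (repr x) (repr y)).

Lemma adj_cls_mul i j l (E : i + j = l) t u :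
  adj_cls (At_mul E t u) = adj_mul E (adj_cls t) (adj_cls u).
Proof. by apply/adj_clsE/ae_mul; apply/ae_sym/adj_reprE. Qed.

Lemma adj_mulDl i j l (E : i + j = l) x x' y :
  adj_mul E (x + x') y = adj_mul E x y + adj_mul E x' y.
Proof.
elim/adj_ind: x => t; elim/adj_ind: x' => t'; elim/adj_ind: y => u.
by rewrite -!(adj_cls_add, adj_cls_mul); apply/adj_clsE/ae_mulDl.
Qed.

Lemma adj_mulDr i j l (E : i + j = l) x y y' :
  adj_mul E x (y + y') = adj_mul E x y + adj_mul E x y'.
Proof.
elim/adj_ind: x => t; elim/adj_ind: y => u; elim/adj_ind: y' => u'.
by rewrite -!(adj_cls_add, adj_cls_mul); apply/adj_clsE/ae_mulDr.
Qed.

Lemma adj_mulZl i j l (E : i + j = l) r x y :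
  adj_mul E (r *: x) y = r *: adj_mul E x y.
Proof.
elim/adj_ind: x => t; elim/adj_ind: y => u.
by rewrite -adj_cls_scale -!adj_cls_mul -adj_cls_scale; apply/adj_clsE/ae_mulZl.
Qed.

Lemma adj_mulZr i j l (E : i + j = l) r x y :
  adj_mul E x (r *: y) = r *: adj_mul E x y.
Proof.
elim/adj_ind: x => t; elim/adj_ind: y => u.
by rewrite -adj_cls_scale -!adj_cls_mul -adj_cls_scale; apply/adj_clsE/ae_mulZr.
Qed.

Lemma adj_mulA i j m ij jm l (E1 : i + j = ij) (E2 : ij + m = l)
    (E3 : j + m = jm) (E4 : i + jm = l) x y z :
  adj_mul E2 (adj_mul E1 x y) z = adj_mul E4 x (adj_mul E3 y z).
Proof.
elim/adj_ind: x => t; elim/adj_ind: y => u; elim/adj_ind: z => v.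
by rewrite -!adj_cls_mul; apply/adj_clsE/ae_mulA.
Qed.

Lemma adj_mul1l n (E : 0 + n = n) x :
  adj_mul E (adj_cls (At_in (gone A))) x = x.
Proof. by elim/adj_ind: x => t; rewrite -adj_cls_mul; apply/adj_clsE/ae_mul1l. Qed.

Lemma adj_mul1r n (E : n + 0 = n) x :
  adj_mul E x (adj_cls (At_in (gone A))) = x.
Proof. by elim/adj_ind: x => t; rewrite -adj_cls_mul; apply/adj_clsE/ae_mul1r. Qed.

Definition adj_galg : galg k :=
  @GAlg k (fun n => adj n : lmodType k) adj_mul (adj_cls (At_in (gone A)))
    adj_mulDl adj_mulDr adj_mulZl adj_mulZr adj_mulA adj_mul1l adj_mul1r.

Definition adj_in n (a : A n) : adj_galg n := adj_cls (At_in a).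
Definition adj_h : adj_galg 1 := adj_cls At_h.

End Adjunction.

Section Degrees.
Implicit Types i j l m : int.

Lemma deg_h m : m + 1 = 1 -> 0 = m.
Proof. by move/(canRL (addrK 1)); rewrite subrr. Qed.

Lemma deg_dl i j l m : i + j = l -> m + 1 = l -> (i - 1) + j = m.
Proof. by move=> <- /(canRL (addrK 1)) ->; rewrite addrAC. Qed.

Lemma deg_dr i j l m : i + j = l -> m + 1 = l -> i + (j - 1) = m.
Proof. by move=> <- /(canRL (addrK 1)) ->; rewrite addrA. Qed.

End Degrees.

Section Koszul.
Variable k : comPzRingType.

Lemma koszulD i j : koszul k (i + j) = koszul k i * koszul k j.
Proof.
rewrite /koszul -exprD -signr_odd -[RHS]signr_odd; congr (_ ^+ nat_of_bool _).
lia.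
Qed.

Lemma koszul_pred i i' : i' + 1 = i -> koszul k i = - koszul k i'.
Proof. by move=> <-; rewrite koszulD /koszul expr1 mulrN1. Qed.

Lemma koszul_sq i : koszul k i * koszul k i = 1.
Proof. by rewrite /koszul -exprD -signr_odd oddD addbb. Qed.

End Koszul.

(* [adj_dg] is [A<h>/(he = eh = h)] with the differential extending that of [A]
   such that [d h = e]; see [adj_dg_in] and [adj_dg_h]. *)
Section KillIdempotent.
Variables (k : comPzRingType) (A : dgAlg k) (e : A 0).
Hypothesis (de : is_cycle e).
Hypothesis (ee : strict_idempotent e).

Local Notation Ae := (adj_galg e).

Fixpoint adj_dt n (t : adj_term A n) : forall m : int, m + 1 = n -> Ae m :=
  match t in adj_term _ n return forall m : int, m + 1 = n -> Ae m with
  | At_in n a => fun m E => adj_in e (dg_d A E a)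
  | At_h => fun m E => adj_in e (ecast i (A i) (deg_h E) e)
  | At_add n t u => fun m E => adj_dt t E + adj_dt u E
  | At_scale n r t => fun m E => r *: adj_dt t E
  | At_mul i j l E t u => fun m F =>
      gmul (deg_dl E F) (adj_dt t (subrK 1 i)) (adj_cls e u : Ae j) +
      koszul k i *: gmul (deg_dr E F) (adj_cls e t : Ae i) (adj_dt u (subrK 1 j))
  end.

Lemma adj_dt_mul i i' j j' l m (E : i + j = l) (Ei : i' + 1 = i)
    (Ej : j' + 1 = j) (F : m + 1 = l) (E1 : i' + j = m) (E2 : i + j' = m) t u :
  adj_dt (At_mul E t u) F
    = gmul E1 (adj_dt t Ei) (adj_cls e u : Ae j) +
      koszul k i *: gmul E2 (adj_cls e t : Ae i) (adj_dt u Ej).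
Proof.
have Di : i - 1 = i' by rewrite -Ei addrK.
have Dj : j - 1 = j' by rewrite -Ej addrK.
subst i' j'; rewrite /=.
rewrite (eq_irrelevance (deg_dl E F) E1) (eq_irrelevance (deg_dr E F) E2).
by rewrite (eq_irrelevance (subrK 1 i) Ei) (eq_irrelevance (subrK 1 j) Ej).
Qed.

Lemma adj_in0 n : adj_in e (0 : A n) = 0.
Proof. by []. Qed.

Lemma adj_inD n (a b : A n) : adj_in e (a + b) = adj_in e a + adj_in e b.
Proof. by rewrite /adj_in -adj_cls_add; apply/adj_clsE/ae_inD. Qed.

Lemma adj_inZ n r (a : A n) : adj_in e (r *: a) = r *: adj_in e a.
Proof. by rewrite /adj_in -adj_cls_scale; apply/adj_clsE/ae_inZ. Qed.

Lemma adj_inM i j l (E : i + j = l) (a : A i) (b : A j) :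
  adj_in e (gmul E a b) = gmul E (adj_in e a) (adj_in e b).
Proof. by rewrite /adj_in /= -adj_cls_mul; apply/adj_clsE/ae_inM. Qed.

Lemma gmul0l (G : galg k) i j l (E : i + j = l) (b : G j) :
  gmul E (0 : G i) b = 0.
Proof. by rewrite -(scale0r 0) gmulZl scale0r. Qed.

Lemma gmul0r (G : galg k) i j l (E : i + j = l) (a : G i) :
  gmul E a (0 : G j) = 0.
Proof. by rewrite -(scale0r 0) gmulZr scale0r. Qed.

Lemma dg_d_one m (E : m + 1 = 0) : dg_d A E (gone A) = 0.
Proof.
have := dg_leibniz E E E (addr0 0) (addr0 m) (add0r m) (gone A) (gone A).
rewrite gmul1l gmul1r gmul1l /koszul expr0 scale1r => /eqP.
by rewrite -subr_eq0 opprD addNKr oppr_eq0 => /eqP.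
Qed.

Lemma adj_dt_eq n (t u : adj_term A n) : adj_eq e t u ->
  forall m (E : m + 1 = n), adj_dt t E = adj_dt u E.
Proof.
move=> tu; elim: n t u / tu => //=.
- by move=> n t u v _ IH1 _ IH2 m E; rewrite IH1 IH2.
- by move=> n t t' u u' _ IH1 _ IH2 m E; rewrite IH1 IH2.
- by move=> n r t t' _ IH m E; rewrite IH.
- move=> i j l E t t' u u' /adj_clsE tt' IH1 /adj_clsE uu' IH2 m F.
  by rewrite tt' uu' IH1 IH2.
- by move=> n t u v m E; rewrite addrA.
- by move=> n t u m E; rewrite addrC.
- by move=> n t m E; rewrite linear0 adj_in0 add0r.
- by move=> n t m E; rewrite scaleN1r addNr linear0 adj_in0.
- by move=> n r s t m E; rewrite scalerA.
- by move=> n t m E; rewrite scale1r.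
- by move=> n r t u m E; rewrite scalerDr.
- by move=> n r s t m E; rewrite scalerDl.
- by move=> i j l E t t' u m F; rewrite adj_cls_add !adj_mulDl scalerDr addrACA.
- by move=> i j l E t t' u m F; rewrite adj_cls_add !adj_mulDr scalerDr addrACA.
- move=> i j l E r t u m F; rewrite adj_cls_scale !adj_mulZl scalerDr.
  by rewrite !scalerA mulrC.
- move=> i j l E r t u m F; rewrite adj_cls_scale !adj_mulZr scalerDr.
  by rewrite !scalerA mulrC.
- move=> i j n ij jn l E1 E2 E3 E4 t u v m F.
  have Di : (i - 1) + 1 = i by rewrite subrK.
  have Dj : (j - 1) + 1 = j by rewrite subrK.
  have Dn : (n - 1) + 1 = n by rewrite subrK.
  have Dij : (ij - 1) + 1 = ij by rewrite subrK.
  have Djn : (jn - 1) + 1 = jn by rewrite subrK.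
  have G1 : (ij - 1) + n = m by lia.
  have G2 : ij + (n - 1) = m by lia.
  have G3 : (i - 1) + jn = m by lia.
  have G4 : i + (jn - 1) = m by lia.
  have G5 : (i - 1) + j = ij - 1 by lia.
  have G6 : i + (j - 1) = ij - 1 by lia.
  have G7 : (j - 1) + n = jn - 1 by lia.
  have G8 : j + (n - 1) = jn - 1 by lia.
  rewrite -[LHS]/(adj_dt (At_mul E2 (At_mul E1 t u) v) F).
  rewrite -[RHS]/(adj_dt (At_mul E4 t (At_mul E3 u v)) F).
  rewrite (adj_dt_mul E2 Dij Dn F G1 G2) (adj_dt_mul E1 Di Dj Dij G5 G6).
  rewrite (adj_dt_mul E4 Di Djn F G3 G4) (adj_dt_mul E3 Dj Dn Djn G7 G8).
  rewrite !adj_cls_mul gmulDl gmulDr gmulZl gmulZr scalerDr scalerA.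
  rewrite -[in koszul k ij]E1 koszulD addrA.
  congr (_ + _ + _ *: _); first exact: (@gmulA k Ae).
    by congr (_ *: _); exact: (@gmulA k Ae).
  exact: (@gmulA k Ae).
- move=> n E t m F.
  have G1 : -1 + n = m by lia.
  have G2 : 0 + m = m by lia.
  rewrite -[LHS]/(adj_dt (At_mul E (At_in (gone A)) t) F).
  rewrite (adj_dt_mul E (addNr 1) F F G1 G2) [adj_dt (At_in _) _]/= dg_d_one adj_in0 gmul0l add0r.
  by rewrite /koszul expr0 scale1r; exact: (@gmul1l k Ae).
- move=> n E t m F.
  have G1 : m + 0 = m by lia.
  have G2 : n + -1 = m by lia.
  rewrite -[LHS]/(adj_dt (At_mul E t (At_in (gone A))) F).
  rewrite (adj_dt_mul E F (addNr 1) F G1 G2) [adj_dt (At_in _) _]/= dg_d_one adj_in0 gmul0r scaler0.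
  by rewrite addr0; exact: (@gmul1r k Ae).
- by move=> n a b m E; rewrite linearD adj_inD.
- by move=> n r a m E; rewrite linearZ adj_inZ.
- move=> i j l E a b m F.
  rewrite -[RHS]/(gmul (deg_dl E F) (adj_in e (dg_d A (subrK 1 i) a))
                    (adj_in e b) +
                  koszul k i *: gmul (deg_dr E F) (adj_in e a)
                    (adj_in e (dg_d A (subrK 1 j) b))).
  rewrite -!adj_inM -adj_inZ -adj_inD.
  congr adj_in; exact: dg_leibniz.
- move=> E m F; have Dm : m = 0 by lia.
  subst m; rewrite -[LHS]/(adj_dt (At_mul E (At_h A) (At_in e)) F).
  rewrite (adj_dt_mul E F (addNr 1) F (addr0 0) (subrr 1)).
  rewrite [adj_dt (At_in _) _]/= [adj_dt (At_h _) _]/=.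
  rewrite de adj_in0 gmul0r scaler0 addr0 (eq_irrelevance (deg_h F) erefl) /=.
  by rewrite -[LHS]/(gmul (addr0 0) (adj_in e e) (adj_in e e)) -adj_inM [gmul _ e e]ee.
- move=> E m F; have Dm : m = 0 by lia.
  subst m; rewrite -[LHS]/(adj_dt (At_mul E (At_in e) (At_h A)) F).
  rewrite (adj_dt_mul E (addNr 1) F F (addNr 1) (addr0 0)).
  rewrite [adj_dt (At_in _) _]/= [adj_dt (At_h _) _]/=.
  rewrite de adj_in0 gmul0l add0r (eq_irrelevance (deg_h F) erefl) /=.
  rewrite /koszul expr0 scale1r.
  by rewrite -[LHS]/(gmul (addr0 0) (adj_in e e) (adj_in e e)) -adj_inM [gmul _ e e]ee.
Qed.

Definition adj_d_fun n m (E : m + 1 = n) (x : Ae n) : Ae m :=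
  adj_dt (repr (x : adj e n)) E.

Lemma adj_d_cls n m (E : m + 1 = n) t : adj_d_fun E (adj_cls e t) = adj_dt t E.
Proof. exact/adj_dt_eq/adj_reprE. Qed.

Lemma adj_d_linear n m (E : m + 1 = n) : linear (adj_d_fun E).
Proof.
move=> r; elim/adj_ind=> t; elim/adj_ind=> u.
by rewrite -adj_cls_scale -adj_cls_add !adj_d_cls.
Qed.

HB.instance Definition _ n m (E : m + 1 = n) :=
  GRing.isLinear.Build k (Ae n) (Ae m) _ (adj_d_fun E) (adj_d_linear E).

Definition adj_d n m (E : m + 1 = n) : {linear Ae n -> Ae m} := adj_d_fun E.

Lemma adj_d_leibniz i i' j j' l l' (Ei : i' + 1 = i) (Ej : j' + 1 = j)
    (El : l' + 1 = l) (E : i + j = l) (E1 : i' + j = l') (E2 : i + j' = l')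
    (x : Ae i) (y : Ae j) :
  adj_d El (gmul E x y)
    = gmul E1 (adj_d Ei x) y + koszul k i *: gmul E2 x (adj_d Ej y).
Proof.
elim/adj_ind: x => t; elim/adj_ind: y => u.
rewrite [gmul E _ _]/= -adj_cls_mul /= !adj_d_cls; exact: adj_dt_mul.
Qed.

Lemma adj_dd n m p (E : m + 1 = n) (F : p + 1 = m) x : adj_d F (adj_d E x) = 0.
Proof.
elim/adj_ind: x => t; rewrite [adj_d E _]/= adj_d_cls.
elim: t m p E F => {n}
  [n a||n t IHt u IHu|n r t IHt|i j l D t IHt u IHu] m p E F.
- by rewrite /= adj_d_cls /= dg_dd.
- have Dm : 0 = m by lia.
  case: m / Dm E F => E F; rewrite /= (eq_irrelevance (deg_h E) erefl) adj_d_cls /=.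
  by rewrite de.
- by rewrite linearD IHt IHu addr0.
- by rewrite linearZ IHt; exact: scaler0.
have Di : (i - 1) + 1 = i by rewrite subrK.
have Dj : (j - 1) + 1 = j by rewrite subrK.
have Di2 : (i - 1 - 1) + 1 = i - 1 by rewrite subrK.
have Dj2 : (j - 1 - 1) + 1 = j - 1 by rewrite subrK.
have G1 : (i - 1) + j = m by lia.
have G2 : i + (j - 1) = m by lia.
have G3 : (i - 1 - 1) + j = p by lia.
have G4 : (i - 1) + (j - 1) = p by lia.
have G5 : i + (j - 1 - 1) = p by lia.
rewrite (adj_dt_mul D Di Dj E G1 G2) linearD [X in _ + X]linearZ.
rewrite (adj_d_leibniz Di2 Dj F G1 G3 G4) (adj_d_leibniz Di Dj2 F G2 G4 G5).
rewrite IHt IHu !(@gmul0l Ae, @gmul0r Ae) !scaler0 add0r addr0.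
rewrite ![adj_d _ (adj_cls e _)]/= !adj_d_cls (koszul_pred k Di).
set x := gmul G4 _ _; rewrite -[X in _ + X]/(- koszul k (i - 1) *: x) scaleNr.
exact: subrr.
Qed.

Definition adj_dg : dgAlg k := @DGAlg k Ae adj_d adj_dd adj_d_leibniz.

Lemma adj_dg_in n m (E : m + 1 = n) (a : A n) :
  dg_d adj_dg E (adj_in e a) = adj_in e (dg_d A E a).
Proof. exact: adj_d_cls. Qed.

Lemma adj_dg_h (E : 0 + 1 = 1 :> int) : dg_d adj_dg E (adj_h e) = adj_in e e.
Proof.
by rewrite [LHS]adj_d_cls /= (eq_irrelevance (deg_h E) erefl).
Qed.

End KillIdempotent.

(* Main.v *)
From HB Require Import structures.
Require Import Defs.
From mathcomp Require Import all_boot all_order all_algebra.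
From mathcomp Require Import generic_quotient boolp zify.

(** Lift [e] along the surjective quasi-isomorphism [q] to a cycle [z] of [Q]; it is
idempotent only up to a boundary.  Killing an idempotent [z] amounts to making
[1 - z] invertible, and for an idempotent a right inverse is enough.  So let
[kill z] be [Q<y, u>] with [d y = 0] and [d u = y - z y - 1], that is, [Q] with a
right inverse [y] of [1 - z] adjoined up to the homotopy [u].  Two cells are
attached, hence [Q -> kill z] is a cofibration ([kill_cofibration]), and [z]
becomes a boundary since [z (1 - z)] is one ([kill_in_boundary]).

Let [B] be an algebra under [Q] in which [z] is a boundary.  Then [1 - z] acts on
[B] as a quasi-isomorphism, so the pairs [(y, u)] in [B] form a contractible
space: there is a map [kill z -> B] under [Q] ([kill_hom_exists]), and any two of
them are homotopic, hence equal on homology ([kill_hom_unique]).  A zigzag under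
[Q] acts on homology, by an action that only depends on its class in the
localisation ([zz_eq_rel]), and all maps from [kill z] are compatible with this
action ([zz_rel_kill]).  It follows that [kill z -> D] is a quasi-isomorphism
for every derived quotient [D] ([kill_derived_quotient]).

The algebra [adj_dg], which is [A<h>/(he = eh = h)], has the same two properties
among the algebras [B] under [A] in which [e] is a boundary: the elements [h] of
[eBe] with [d h = e] form a contractible space because [eBe] is acyclic
([adj_hom_exists], [adj_hom_unique]).  So does the pushout of [kill z] along [q],
which is [kill e] over [A] ([kill_pushout]).  Hence there are maps between
[adj_dg] and [kill e] in both directions.  The composite on [adj_dg] is the
identity on homology by uniqueness.  The composite on [kill e] agrees on homology
with the identity after restriction to [kill z], by uniqueness there, and
left properness of [A] says that [kill z -> kill e] is a quasi-isomorphism, so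
the restriction loses nothing ([adj_kill_quasi_iso]).  Altogether [adj_dg],
[kill e], [kill z] and [D] are quasi-isomorphic. *)

Set Implicit Arguments.
Unset Strict Implicit.
Unset Printing Implicit Defensive.

Import GRing.Theory.
Local Open Scope ring_scope.
Local Open Scope quotient_scope.

(** * Products, cycles and boundaries *)

Section GradedProduct.
Variables (k : comPzRingType) (G : galg k) (i j l : int) (E : i + j = l).

Lemma gmulNl (a : G i) (b : G j) : gmul E (- a) b = - gmul E a b.
Proof. by rewrite -scaleN1r gmulZl scaleN1r. Qed.

Lemma gmulNr (a : G i) (b : G j) : gmul E a (- b) = - gmul E a b.
Proof. by rewrite -scaleN1r gmulZr scaleN1r. Qed.

Lemma gmulBl (a a' : G i) (b : G j) :
  gmul E (a - a') b = gmul E a b - gmul E a' b.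
Proof. by rewrite gmulDl gmulNl. Qed.

Lemma gmulBr (a : G i) (b b' : G j) :
  gmul E a (b - b') = gmul E a b - gmul E a b'.
Proof. by rewrite gmulDr gmulNr. Qed.

End GradedProduct.

Lemma koszul1 (k : comPzRingType) : koszul k 1 = -1.
Proof. exact: expr1. Qed.

Section Homology.
Variable k : comPzRingType.
Implicit Types A B C : dgAlg k.

Lemma is_cycleP A m n (E : m + 1 = n) (a : A n) :
  dg_d A E a = 0 -> is_cycle a.
Proof.
move=> da m' E'; have Em : m' = m by lia.
by subst m'; rewrite (eq_irrelevance E' E).
Qed.

Lemma is_boundaryP A m n (E : n + 1 = m) (a : A n) :
  is_boundary a <-> exists b, a = dg_d A E b.
Proof. by case: m / E. Qed.

Lemma is_cycle0 A n : is_cycle (0 : A n).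
Proof. by move=> m E; rewrite linear0. Qed.

Lemma is_cycleN A n (a : A n) : is_cycle a -> is_cycle (- a).
Proof. by move=> za m E; rewrite linearN za oppr0. Qed.

Lemma is_cycleD A n (a b : A n) : is_cycle a -> is_cycle b -> is_cycle (a + b).
Proof. by move=> za zb m E; rewrite linearD za zb addr0. Qed.

Lemma is_cycleB A n (a b : A n) : is_cycle a -> is_cycle b -> is_cycle (a - b).
Proof. by move=> za zb; apply: is_cycleD za (is_cycleN zb). Qed.

Lemma is_cycle_d A m n (E : m + 1 = n) (a : A n) : is_cycle (dg_d A E a).
Proof. by move=> p F; rewrite dg_dd. Qed.

Lemma is_cycle1 A : is_cycle (gone A).
Proof. by move=> m E; exact: dg_d_one. Qed.

Lemma is_boundary_d A m n (E : n + 1 = m) (a : A m) : is_boundary (dg_d A E a).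
Proof. by apply/(is_boundaryP E); exists a. Qed.

Lemma is_boundary0 A n : is_boundary (0 : A n).
Proof. by exists 0; rewrite linear0. Qed.

Lemma is_boundaryN A n (a : A n) : is_boundary a -> is_boundary (- a).
Proof. by case=> b ->; exists (- b); rewrite linearN. Qed.

Lemma is_boundaryD A n (a b : A n) :
  is_boundary a -> is_boundary b -> is_boundary (a + b).
Proof. by case=> x -> [y ->]; exists (x + y); rewrite linearD. Qed.

Lemma homologous_refl A n (a : A n) : homologous a a.
Proof. by rewrite /homologous subrr; apply: is_boundary0. Qed.

Lemma homologous_sym A n (a b : A n) : homologous a b -> homologous b a.
Proof. by rewrite /homologous => /is_boundaryN; rewrite opprB. Qed.

Lemma homologous_trans A n (b a c : A n) :
  homologous a b -> homologous b c -> homologous a c.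
Proof.
by move=> ab bc; have := is_boundaryD ab bc; rewrite addrA subrK.
Qed.

Lemma is_boundary_homologous A n (a b : A n) :
  homologous a b -> is_boundary b -> is_boundary a.
Proof. by move=> /is_boundaryD + /[dup] _ zb => /(_ _ zb); rewrite subrK. Qed.

Lemma hom_cycle A B (f : dgHom A B) n (a : A n) : is_cycle a -> is_cycle (f n a).
Proof. by move=> za m E; rewrite -hmap_d za linear0. Qed.

Lemma hom_boundary A B (f : dgHom A B) n (a : A n) :
  is_boundary a -> is_boundary (f n a).
Proof. by case=> b ->; rewrite hmap_d; apply: is_boundary_d. Qed.

Lemma hom_homologous A B (f : dgHom A B) n (a b : A n) :
  homologous a b -> homologous (f n a) (f n b).
Proof. by move/(hom_boundary f); rewrite linearB. Qed.

Lemma quasi_iso_boundary A B (f : dgHom A B) n (a : A n) :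
  quasi_iso f -> is_cycle a -> is_boundary (f n a) -> is_boundary a.
Proof.
move=> qf za bfa; have [inj _] := qf n.
have := inj a 0 za (@is_cycle0 A n); rewrite /homologous linear0 !subr0.
exact.
Qed.

Lemma d_mul_cycler A i i' j l l' (Ei : i' + 1 = i) (El : l' + 1 = l)
    (E : i + j = l) (E1 : i' + j = l') (a : A i) (b : A j) :
  is_cycle b -> dg_d A El (gmul E a b) = gmul E1 (dg_d A Ei a) b.
Proof.
move=> zb; have E2 : i + (j - 1) = l' by lia.
by rewrite (dg_leibniz Ei (subrK 1 j) El E E1 E2) zb gmul0r scaler0 addr0.
Qed.

Lemma d_mul_cyclel A i j j' l l' (Ej : j' + 1 = j) (El : l' + 1 = l)
    (E : i + j = l) (E2 : i + j' = l') (a : A i) (b : A j) :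
  is_cycle a ->
  dg_d A El (gmul E a b) = koszul k i *: gmul E2 a (dg_d A Ej b).
Proof.
move=> za; have E1 : (i - 1) + j = l' by lia.
by rewrite (dg_leibniz (subrK 1 i) Ej El E E1 E2) za gmul0l add0r.
Qed.

Lemma is_cycleM A i j l (E : i + j = l) (a : A i) (b : A j) :
  is_cycle a -> is_cycle b -> is_cycle (gmul E a b).
Proof.
move=> za zb m F; have E1 : (i - 1) + j = m by lia.
by rewrite (d_mul_cycler (subrK 1 i) F E E1) // za gmul0l.
Qed.

Definition same_homology A B (f g : dgHom A B) : Prop :=
  forall n (a : A n), is_cycle a -> homologous (f n a) (g n a).

Lemma quasi_iso_inverse A B (f : dgHom A B) (g : dgHom B A) :
  same_homology (hcomp g f) (hid A) -> same_homology (hcomp f g) (hid B) ->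
  quasi_iso f.
Proof.
move=> gf fg n; split=> [a b za zb fab|c zc].
  apply: homologous_trans (homologous_sym (gf n a za)) _.
  apply: homologous_trans (gf n b zb); exact: hom_homologous fab.
by exists (g n c); [apply: hom_cycle|apply: fg].
Qed.

(** Correct a preimage of [c] first by a chain that repairs its differential, then by
a cycle that brings the chain back into the kernel: the kernel of a surjective
quasi-isomorphism is acyclic. *)
Lemma acyclic_fibration_lift B C (p : dgHom B C) m n (E : m + 1 = n)
    (w : B m) (c : C n) :
  fibration p -> quasi_iso p -> is_cycle w -> dg_d C E c = p m w ->
  exists b, p n b = c /\ dg_d B E b = w.
Proof.
move=> fp qp zw dc; have [b0 pb0] := fp n c.
have zw0 : is_cycle (w - dg_d B E b0).
  by apply: is_cycleB => //; apply: is_cycle_d.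
have : is_boundary (w - dg_d B E b0).
  apply: (quasi_iso_boundary qp) => //.
  by rewrite linearB hmap_d pb0 dc subrr; apply: is_boundary0.
move=> /(is_boundaryP E)[b1 db1].
have zpb1 : is_cycle (p n b1).
  by apply: (@is_cycleP _ _ _ E); rewrite -hmap_d -db1 linearB hmap_d pb0 dc subrr.
have [_ /(_ _ zpb1)[a za [c' pa]]] := qp n.
have [b' pb'] := fp _ c'.
exists (b0 + (b1 - a + dg_d B erefl b')); split.
  by rewrite !linearD linearN hmap_d pb0 pb' -pa -[p n b1 - _]opprB addNr addr0.
by rewrite !linearD linearN dg_dd za subr0 addr0 -db1 addrC subrK.
Qed.

Lemma cofibration_comp A B C (j : dgHom B C) (i : dgHom A B) :
  cofibration i -> cofibration j -> cofibration (hcomp j i).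
Proof.
move=> ci cj Y Z p fp qp u v puv.
have [h [hi ph]] := ci Y Z p fp qp u (hcomp v j) puv.
have [h' [hj ph']] := cj Y Z p fp qp h v ph.
exists h'; split=> // n a; rewrite -hi; exact: hj.
Qed.

End Homology.

(** * Attaching a cell *)

Section Cell.
Variables (k : comPzRingType) (R : dgAlg k) (p q : int) (Epq : p + 1 = q).
Variable c : R p.

(** Formal expressions in the elements of [R], one new generator of degree [q] and
all the operations of a dg algebra, including the differential. *)
Inductive cell_term : int -> Type :=
| Ct_in n (a : R n) : cell_term n
| Ct_gen : cell_term q
| Ct_add n (t u : cell_term n) : cell_term n
| Ct_scale n (r : k) (t : cell_term n) : cell_term n
| Ct_mul (i j l : int) (E : i + j = l) (t : cell_term i) (u : cell_term j) :
    cell_term l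
| Ct_d (n m : int) (E : m + 1 = n) (t : cell_term n) : cell_term m.

Fixpoint cell_eval (B : dgAlg k) (f : dgHom R B) (b : B q) n
    (t : cell_term n) : B n :=
  match t in cell_term n return B n with
  | Ct_in n a => f n a
  | Ct_gen => b
  | Ct_add _ t u => cell_eval f b t + cell_eval f b u
  | Ct_scale _ r t => r *: cell_eval f b t
  | Ct_mul _ _ _ E t u => gmul E (cell_eval f b t) (cell_eval f b u)
  | Ct_d _ _ E t => dg_d B E (cell_eval f b t)
  end.

(** [R<x | d x = c>] is the quotient of the terms by the equations that hold in all
algebras under [R] with a chosen element of boundary [c].  Being quantified over
all models, this relation satisfies each axiom of dg algebras because every model
does, and the quotient is the initial model. *)
Definition cell_eq n (t u : cell_term n) : Prop :=
  forall (B : dgAlg k) (f : dgHom R B) (b : B q),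
    dg_d B Epq b = f p c -> cell_eval f b t = cell_eval f b u.

Section Quotient.
Variable n : int.

HB.instance Definition _ := gen_eqMixin (cell_term n).
HB.instance Definition _ := gen_choiceMixin (cell_term n).

Definition cell_rel (t u : cell_term n) : bool := `[< cell_eq t u >].

Lemma cell_rel_refl : reflexive cell_rel.
Proof. by move=> t; apply/asboolP. Qed.

Lemma cell_rel_sym : symmetric cell_rel.
Proof.
by move=> t u; apply/asboolP/asboolP => tu B f b fb; rewrite tu.
Qed.

Lemma cell_rel_trans : transitive cell_rel.
Proof.
move=> u t v /asboolP tu /asboolP uv; apply/asboolP => B f b fb.
by rewrite tu // uv.
Qed.

Canonical cell_equiv :=
  EquivRel cell_rel cell_rel_refl cell_rel_sym cell_rel_trans.

Definition cell_quot : Type := {eq_quot cell_equiv}.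
HB.instance Definition _ := Choice.on cell_quot.
HB.instance Definition _ := EqQuotient.on cell_quot.

Definition cell_cls (t : cell_term n) : cell_quot := \pi_cell_quot t.

Lemma cell_clsE t u : cell_eq t u -> cell_cls t = cell_cls u.
Proof. by move=> tu; apply/eqmodP/asboolP. Qed.

Definition cell_val (B : dgAlg k) (f : dgHom R B) (b : B q) (x : cell_quot) :
  B n := cell_eval f b (repr x).

Lemma cell_valE B (f : dgHom R B) b t : dg_d B Epq b = f p c ->
  cell_val f b (cell_cls t) = cell_eval f b t.
Proof.
move=> fb; have /eqmodP/asboolP tt : cell_cls (repr (cell_cls t)) = cell_cls t.
  exact: reprK.
exact: tt.
Qed.

(** Elements are separated by their values in the models; every identity of the
quotient is proved by evaluating it. *)
Lemma cell_val_inj (x y : cell_quot) :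
  (forall B (f : dgHom R B) b, dg_d B Epq b = f p c ->
     cell_val f b x = cell_val f b y) -> x = y.
Proof. by move=> xy; rewrite -[x]reprK -[y]reprK; apply: cell_clsE. Qed.

Definition cell_add (x y : cell_quot) := cell_cls (Ct_add (repr x) (repr y)).
Definition cell_scale r (x : cell_quot) := cell_cls (Ct_scale r (repr x)).
Definition cell_zero := cell_cls (Ct_in 0).

Section Values.
Variables (B : dgAlg k) (f : dgHom R B) (b : B q).
Hypothesis fb : dg_d B Epq b = f p c.

Lemma cell_val_add x y :
  cell_val f b (cell_add x y) = cell_val f b x + cell_val f b y.
Proof. exact: cell_valE. Qed.

Lemma cell_val_scale r x : cell_val f b (cell_scale r x) = r *: cell_val f b x.
Proof. exact: cell_valE. Qed.

Lemma cell_val_zero : cell_val f b cell_zero = 0.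
Proof. by rewrite cell_valE //= linear0. Qed.

End Values.

Let cell_valS := (cell_val_add, cell_val_scale, cell_val_zero).

Lemma cell_addA : associative cell_add.
Proof.
by move=> x y z; apply: cell_val_inj => B f b fb; rewrite !cell_valS // addrA.
Qed.

Lemma cell_addC : commutative cell_add.
Proof.
by move=> x y; apply: cell_val_inj => B f b fb; rewrite !cell_valS // addrC.
Qed.

Lemma cell_add0 : left_id cell_zero cell_add.
Proof.
by move=> x; apply: cell_val_inj => B f b fb; rewrite !cell_valS // add0r.
Qed.

Lemma cell_addN : left_inverse cell_zero (cell_scale (-1)) cell_add.
Proof.
move=> x; apply: cell_val_inj => B f b fb.
by rewrite !cell_valS // scaleN1r addNr.
Qed.

HB.instance Definition _ :=
  GRing.isZmodule.Build cell_quot cell_addA cell_addC cell_add0 cell_addN.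

Lemma cell_scaleA r s x : cell_scale r (cell_scale s x) = cell_scale (r * s) x.
Proof.
by apply: cell_val_inj => B f b fb; rewrite !cell_valS // scalerA.
Qed.

Lemma cell_scale1 : left_id 1 cell_scale.
Proof.
by move=> x; apply: cell_val_inj => B f b fb; rewrite !cell_valS // scale1r.
Qed.

Lemma cell_scaleDr : right_distributive cell_scale +%R.
Proof.
move=> r x y; apply: cell_val_inj => B f b fb.
by rewrite !cell_valS // scalerDr.
Qed.

Lemma cell_scaleDl x : {morph cell_scale^~ x : r s / r + s}.
Proof.
by move=> r s; apply: cell_val_inj => B f b fb; rewrite !cell_valS // scalerDl.
Qed.

HB.instance Definition _ :=
  GRing.Zmodule_isLmodule.Build k cell_quot
    cell_scaleA cell_scale1 cell_scaleDr cell_scaleDl.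

End Quotient.

Definition cell_mul i j l (E : i + j = l) (x : cell_quot i) (y : cell_quot j) :
  cell_quot l := cell_cls (Ct_mul E (repr x) (repr y)).

Definition cell_d_fun n m (E : m + 1 = n) (x : cell_quot n) : cell_quot m :=
  cell_cls (Ct_d E (repr x)).

Section Values.
Variables (B : dgAlg k) (f : dgHom R B) (b : B q).
Hypothesis fb : dg_d B Epq b = f p c.

Lemma cell_valD n (x y : cell_quot n) :
  cell_val f b (x + y) = cell_val f b x + cell_val f b y.
Proof. exact: cell_val_add. Qed.

Lemma cell_valZ n r (x : cell_quot n) :
  cell_val f b (r *: x) = r *: cell_val f b x.
Proof. exact: cell_val_scale. Qed.

Lemma cell_val0 n : cell_val f b (0 : cell_quot n) = 0.
Proof. exact: cell_val_zero. Qed.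

Lemma cell_valM i j l (E : i + j = l) x y :
  cell_val f b (cell_mul E x y) = gmul E (cell_val f b x) (cell_val f b y).
Proof. exact: cell_valE. Qed.

Lemma cell_val_d n m (E : m + 1 = n) x :
  cell_val f b (cell_d_fun E x) = dg_d B E (cell_val f b x).
Proof. exact: cell_valE. Qed.

Lemma cell_val_in n (a : R n) : cell_val f b (cell_cls (Ct_in a)) = f n a.
Proof. exact: cell_valE. Qed.

Lemma cell_val_gen : cell_val f b (cell_cls Ct_gen) = b.
Proof. exact: cell_valE. Qed.

End Values.

Let cell_valS :=
  (cell_valD, cell_valZ, cell_val0, cell_valM, cell_val_d, cell_val_in,
   cell_val_gen).

Lemma cell_mulDl i j l (E : i + j = l) x x' y :
  cell_mul E (x + x') y = cell_mul E x y + cell_mul E x' y.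
Proof. by apply: cell_val_inj => B f b fb; rewrite !cell_valS // gmulDl. Qed.

Lemma cell_mulDr i j l (E : i + j = l) x y y' :
  cell_mul E x (y + y') = cell_mul E x y + cell_mul E x y'.
Proof. by apply: cell_val_inj => B f b fb; rewrite !cell_valS // gmulDr. Qed.

Lemma cell_mulZl i j l (E : i + j = l) r x y :
  cell_mul E (r *: x) y = r *: cell_mul E x y.
Proof. by apply: cell_val_inj => B f b fb; rewrite !cell_valS // gmulZl. Qed.

Lemma cell_mulZr i j l (E : i + j = l) r x y :
  cell_mul E x (r *: y) = r *: cell_mul E x y.
Proof. by apply: cell_val_inj => B f b fb; rewrite !cell_valS // gmulZr. Qed.

Lemma cell_mulA i j m ij jm l (E1 : i + j = ij) (E2 : ij + m = l)
    (E3 : j + m = jm) (E4 : i + jm = l) x y z :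
  cell_mul E2 (cell_mul E1 x y) z = cell_mul E4 x (cell_mul E3 y z).
Proof.
by apply: cell_val_inj => B f b fb; rewrite !cell_valS //; apply: gmulA.
Qed.

Lemma cell_mul1l n (E : 0 + n = n) x :
  cell_mul E (cell_cls (Ct_in (gone R))) x = x.
Proof.
by apply: cell_val_inj => B f b fb; rewrite !cell_valS // hmap_one gmul1l.
Qed.

Lemma cell_mul1r n (E : n + 0 = n) x :
  cell_mul E x (cell_cls (Ct_in (gone R))) = x.
Proof.
by apply: cell_val_inj => B f b fb; rewrite !cell_valS // hmap_one gmul1r.
Qed.

Definition cell_galg : galg k :=
  @GAlg k (fun n => cell_quot n : lmodType k) cell_mul
    (cell_cls (Ct_in (gone R))) cell_mulDl cell_mulDr cell_mulZl cell_mulZr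
    cell_mulA cell_mul1l cell_mul1r.

Lemma cell_d_linear n m (E : m + 1 = n) : linear (@cell_d_fun n m E).
Proof.
move=> r x y; apply: cell_val_inj => B f b fb.
by rewrite !cell_valS // linearD linearZ.
Qed.

HB.instance Definition _ n m (E : m + 1 = n) :=
  GRing.isLinear.Build k (cell_galg n) (cell_galg m) _ (@cell_d_fun n m E)
    (@cell_d_linear n m E).

Definition cell_d n m (E : m + 1 = n) : {linear cell_galg n -> cell_galg m} :=
  @cell_d_fun n m E.

Lemma cell_dd n m l (E : m + 1 = n) (F : l + 1 = m) x :
  cell_d F (cell_d E x) = 0.
Proof.
by apply: cell_val_inj => B f b fb; rewrite !cell_valS // dg_dd.
Qed.

Lemma cell_leibniz i i' j j' l l' (Ei : i' + 1 = i) (Ej : j' + 1 = j)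
    (El : l' + 1 = l) (E : i + j = l) (E1 : i' + j = l') (E2 : i + j' = l')
    (x : cell_galg i) (y : cell_galg j) :
  cell_d El (gmul E x y)
    = gmul E1 (cell_d Ei x) y + koszul k i *: gmul E2 x (cell_d Ej y).
Proof.
apply: cell_val_inj => B f b fb; rewrite !cell_valS //.
exact: dg_leibniz.
Qed.

Definition cell : dgAlg k := @DGAlg k cell_galg cell_d cell_dd cell_leibniz.

Definition cell_in_fun n (a : R n) : cell n := cell_cls (Ct_in a).

Lemma cell_in_linear n : linear (@cell_in_fun n).
Proof.
move=> r x y; apply: cell_val_inj => B f b fb.
by rewrite !cell_valS // linearD linearZ.
Qed.

HB.instance Definition _ n :=
  GRing.isLinear.Build k (R n) (cell n) _ (@cell_in_fun n) (@cell_in_linear n).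

Lemma cell_in_d n m (E : m + 1 = n) (a : R n) :
  cell_in_fun (dg_d R E a) = dg_d cell E (cell_in_fun a).
Proof.
by apply: cell_val_inj => B f b fb; rewrite !cell_valS // hmap_d.
Qed.

Lemma cell_in_mul i j l (E : i + j = l) (x : R i) (y : R j) :
  cell_in_fun (gmul E x y) = gmul E (cell_in_fun x) (cell_in_fun y).
Proof.
by apply: cell_val_inj => B f b fb; rewrite !cell_valS // hmap_mul.
Qed.

Definition cell_in : dgHom R cell :=
  @DGHom k R cell (fun n => @cell_in_fun n : {linear R n -> cell n})
    cell_in_d cell_in_mul erefl.

Definition cell_gen : cell q := cell_cls Ct_gen.

Lemma cell_d_gen : dg_d cell Epq cell_gen = cell_in p c.
Proof. by apply: cell_val_inj => B f b fb; rewrite !cell_valS. Qed.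

Section Rec.
Variables (B : dgAlg k) (f : dgHom R B) (b : B q).
Hypothesis fb : dg_d B Epq b = f p c.

Definition cell_rec_fun n (x : cell n) : B n := cell_val f b x.

Lemma cell_rec_linear n : linear (@cell_rec_fun n).
Proof. by move=> r x y; rewrite /cell_rec_fun !cell_valS. Qed.

HB.instance Definition _ n :=
  GRing.isLinear.Build k (cell n) (B n) _ (@cell_rec_fun n)
    (@cell_rec_linear n).

Lemma cell_rec_one : cell_rec_fun (gone cell) = gone B.
Proof. by rewrite /cell_rec_fun cell_valS // hmap_one. Qed.

Definition cell_rec : dgHom cell B :=
  @DGHom k cell B (fun n => @cell_rec_fun n : {linear cell n -> B n})
    (cell_val_d fb) (cell_valM fb) cell_rec_one.

Lemma cell_rec_in : heq (hcomp cell_rec cell_in) f.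
Proof. by move=> n a; apply: cell_val_in. Qed.

Lemma cell_rec_gen : cell_rec q cell_gen = b.
Proof. exact: cell_val_gen. Qed.

End Rec.

Lemma cell_hom_ext B (f g : dgHom cell B) :
  heq (hcomp f cell_in) (hcomp g cell_in) -> f q cell_gen = g q cell_gen ->
  heq f g.
Proof.
move=> fg fgx n x; rewrite -[x]reprK.
elim: (repr x) => {n x}
  [n a||n t IHt u IHu|n r t IHt|i j l E t IHt u IHu|n m E t IHt].
- exact: fg.
- exact: fgx.
- have -> : \pi_(cell_quot n) (Ct_add t u) = (cell_cls t + cell_cls u : cell n).
    by apply: cell_val_inj => C h b hb; rewrite !cell_valS // !cell_valE.
  by rewrite !linearD IHt IHu.
- have -> : \pi_(cell_quot n) (Ct_scale r t) = (r *: cell_cls t : cell n).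
    by apply: cell_val_inj => C h b hb; rewrite !cell_valS // !cell_valE.
  by rewrite !linearZ IHt.
- have -> : \pi_(cell_quot l) (Ct_mul E t u) =
      gmul E (cell_cls t : cell i) (cell_cls u : cell j).
    by apply: cell_val_inj => C h b hb; rewrite !cell_valS // !cell_valE.
  by rewrite !hmap_mul IHt IHu.
- have -> : \pi_(cell_quot m) (Ct_d E t) = dg_d cell E (cell_cls t : cell n).
    by apply: cell_val_inj => C h b hb; rewrite !cell_valS // !cell_valE.
  by rewrite !hmap_d IHt.
Qed.

(** A lifting problem against [R -> R<x | d x = c>] asks for a preimage of the image
of [x] with a prescribed boundary. *)
Lemma cell_cofibration : is_cycle c -> cofibration cell_in.
Proof.
move=> zc B C pi fpi qpi u v puv.
have dv : dg_d C Epq (v q cell_gen) = pi p (u p c).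
  by rewrite -hmap_d cell_d_gen; rewrite [RHS]puv.
have [b [pb db]] := acyclic_fibration_lift fpi qpi (hom_cycle u zc) dv.
exists (cell_rec db); split; first exact: cell_rec_in.
apply: cell_hom_ext => [n a|].
  rewrite -[RHS]/(hcomp v cell_in n a) -puv; congr (pi n _).
  exact: cell_rec_in.
by rewrite -[LHS]/(pi q (cell_rec db q cell_gen)) cell_rec_gen.
Qed.

End Cell.

(** * The path algebra *)

Section Path.
Variables (k : comPzRingType) (B : dgAlg k).

(** The path object of [B]: the upper triangular matrices with diagonal [(a, a')] and
with an off-diagonal entry [s] of degree one higher.  A map to it is a pair of
maps with a homotopy [s] between them, where
[s (x y) = s (x) f' (y) + (-1)^|x| f (x) s (y)] for the ends [f] and [f']. *)
Definition path_mod n : Type := (B n * B n * B (n + 1)%R)%type.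
HB.instance Definition _ n := GRing.Lmodule.on (path_mod n).

Lemma path_degl i j l : i + j = l -> (i + 1) + j = l + 1 :> int.
Proof. by move=> <-; rewrite addrAC. Qed.

Lemma path_degr i j l : i + j = l -> i + (j + 1) = l + 1 :> int.
Proof. by move=> <-; rewrite addrA. Qed.

Definition path_mul i j l (E : i + j = l) (x : path_mod i) (y : path_mod j) :
    path_mod l :=
  (gmul E x.1.1 y.1.1, gmul E x.1.2 y.1.2,
   gmul (path_degl E) x.2 y.1.2
     + koszul k i *: gmul (path_degr E) x.1.1 y.2).

Definition path_one : path_mod 0 := (gone B, gone B, 0).

Lemma path_mulDl i j l (E : i + j = l) x x' y :
  path_mul E (x + x') y = path_mul E x y + path_mul E x' y.
Proof.
by congr (_, _, _); rewrite /= ?gmulDl // scalerDr addrACA.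
Qed.

Lemma path_mulDr i j l (E : i + j = l) x y y' :
  path_mul E x (y + y') = path_mul E x y + path_mul E x y'.
Proof.
by congr (_, _, _); rewrite /= ?gmulDr // scalerDr addrACA.
Qed.

Lemma path_mulZl i j l (E : i + j = l) r x y :
  path_mul E (r *: x) y = r *: path_mul E x y.
Proof.
by congr (_, _, _); rewrite /= ?gmulZl // scalerDr !scalerA mulrC.
Qed.

Lemma path_mulZr i j l (E : i + j = l) r x y :
  path_mul E x (r *: y) = r *: path_mul E x y.
Proof.
by congr (_, _, _); rewrite /= ?gmulZr // scalerDr !scalerA mulrC.
Qed.

Lemma path_mulA i j m ij jm l (E1 : i + j = ij) (E2 : ij + m = l)
    (E3 : j + m = jm) (E4 : i + jm = l) x y z :
  path_mul E2 (path_mul E1 x y) z = path_mul E4 x (path_mul E3 y z).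
Proof.
congr (_, _, _); rewrite /= ?(gmulA _ _ E3 E4) //.
rewrite gmulDl gmulDr gmulZl gmulZr scalerDr scalerA -koszulD E1 addrA.
rewrite (gmulA _ _ E3 (path_degl E4)).
rewrite (gmulA _ _ (path_degl E3) (path_degr E4)).
by rewrite (gmulA _ _ (path_degr E3) (path_degr E4)).
Qed.

Lemma path_mul1l n (E : 0 + n = n) x : path_mul E path_one x = x.
Proof.
case: x => [[a a'] s]; congr (_, _, _); rewrite /= ?gmul1l //.
by rewrite gmul0l add0r scale1r.
Qed.

Lemma path_mul1r n (E : n + 0 = n) x : path_mul E x path_one = x.
Proof.
case: x => [[a a'] s]; congr (_, _, _); rewrite /= ?gmul1r //.
by rewrite gmul0r scaler0 addr0.
Qed.

Definition path_galg : galg k :=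
  @GAlg k (fun n => path_mod n : lmodType k) path_mul path_one path_mulDl path_mulDr
    path_mulZl path_mulZr path_mulA path_mul1l path_mul1r.

(** The third component is [a' - a - d s], so that a cycle is a pair of cycles with a
chain joining them.  The cast moves [a' - a] from degree [n] to degree [m + 1]. *)
Definition path_d_fun n m (E : m + 1 = n) (x : path_mod n) : path_mod m :=
  (dg_d B E x.1.1, dg_d B E x.1.2,
   ecast i (B i) (esym E) (x.1.2 - x.1.1) - dg_d B (congr1 (+%R^~ 1) E) x.2).

Lemma path_d_linear n m (E : m + 1 = n) : linear (@path_d_fun n m E).
Proof.
case: n / E => r x y; congr (_, _, _); rewrite /= [dg_d _ _ _]linearP //.
by rewrite !opprD -!scalerN [X in X + _ = _]addrACA [LHS]addrACA -!scalerDr.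
Qed.

HB.instance Definition _ n m (E : m + 1 = n) :=
  GRing.isLinear.Build k (path_galg n) (path_galg m) _ (@path_d_fun n m E)
    (@path_d_linear n m E).

Definition path_d n m (E : m + 1 = n) : {linear path_galg n -> path_galg m} :=
  @path_d_fun n m E.

Lemma path_dd n m p (E : m + 1 = n) (F : p + 1 = m) x :
  path_d F (path_d E x) = 0.
Proof.
move: x; case: n / E; case: m / F => x; congr (_, _, _); rewrite /= ?dg_dd //.
by rewrite [X in _ - X]linearB [X in _ - (X - _)]linearB dg_dd subr0 subrr.
Qed.

Lemma path_leibniz i i' j j' l l' (Ei : i' + 1 = i) (Ej : j' + 1 = j)
    (El : l' + 1 = l) (E : i + j = l) (E1 : i' + j = l') (E2 : i + j' = l')
    (x : path_galg i) (y : path_galg j) :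
  path_d El (gmul E x y)
    = gmul E1 (path_d Ei x) y + koszul k i *: gmul E2 x (path_d Ej y).
Proof.
subst i j l; case: x y => [[a a'] s] [[b b'] t].
congr (_, _, _); rewrite /= ?(dg_leibniz erefl erefl _ _ E1 E2) //.
rewrite linearD [X in _ - (_ + X)]linearZ.
rewrite (dg_leibniz erefl erefl _ _ (path_degl E1) (path_degl E2)).
rewrite (dg_leibniz erefl erefl _ _ (path_degr E1) (path_degr E2)).
rewrite (eq_irrelevance (path_degl E1) E) (eq_irrelevance (path_degr E2) E).
rewrite !gmulBl !gmulBr /=.
have kS m : koszul k (m + 1) = - koszul k m by apply: koszul_pred.
rewrite !kS opprK !(scalerDr, scalerN, scaleNr, opprK, scalerA, mulrN, koszul_sq).
rewrite !scale1r.
rewrite !(opprD, opprK) !addrA.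
(* The right-hand side has the two extra terms [a b'] and [- a b']. *)
by rewrite [RHS](ACl (1*7*3*5*4*8*6*2)) /= [RHS]addrK.
Qed.

Definition path_alg : dgAlg k := @DGAlg k path_galg path_d path_dd path_leibniz.

Definition path_const_fun n (a : B n) : path_alg n := (a, a, 0).

Lemma path_const_linear n : linear (@path_const_fun n).
Proof.
by move=> r x y; congr (_, _, _); rewrite /= scaler0 addr0.
Qed.

HB.instance Definition _ n :=
  GRing.isLinear.Build k (B n) (path_alg n) _ (@path_const_fun n)
    (@path_const_linear n).

Lemma path_const_d n m (E : m + 1 = n) (a : B n) :
  path_const_fun (dg_d B E a) = dg_d path_alg E (path_const_fun a).
Proof. by case: n / E a => a; congr (_, _, _); rewrite /= subrr linear0 subrr. Qed.

Lemma path_const_mul i j l (E : i + j = l) (x : B i) (y : B j) :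
  path_const_fun (gmul E x y) = gmul E (path_const_fun x) (path_const_fun y).
Proof. by congr (_, _, _); rewrite /= gmul0l gmul0r scaler0 addr0. Qed.

Definition path_const : dgHom B path_alg :=
  @DGHom k B path_alg (fun n => @path_const_fun n : {linear B n -> path_alg n})
    path_const_d path_const_mul erefl.

Definition path_start_fun n (x : path_alg n) : B n := x.1.1.
Definition path_end_fun n (x : path_alg n) : B n := x.1.2.

Lemma path_start_linear n : linear (@path_start_fun n).
Proof. by []. Qed.

Lemma path_end_linear n : linear (@path_end_fun n).
Proof. by []. Qed.

HB.instance Definition _ n :=
  GRing.isLinear.Build k (path_alg n) (B n) _ (@path_start_fun n)
    (@path_start_linear n).
HB.instance Definition _ n :=
  GRing.isLinear.Build k (path_alg n) (B n) _ (@path_end_fun n)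
    (@path_end_linear n).

Definition path_start : dgHom path_alg B :=
  @DGHom k path_alg B (fun n => @path_start_fun n : {linear path_alg n -> B n})
    (fun _ _ _ _ => erefl) (fun _ _ _ _ _ _ => erefl) erefl.
Definition path_end : dgHom path_alg B :=
  @DGHom k path_alg B (fun n => @path_end_fun n : {linear path_alg n -> B n})
    (fun _ _ _ _ => erefl) (fun _ _ _ _ _ _ => erefl) erefl.

(** On a cycle the homotopy is a chain whose boundary is the difference of the two
values. *)
Lemma homotopic_same_homology C (F : dgHom C path_alg) (f g : dgHom C B) :
  heq (hcomp path_start F) f -> heq (hcomp path_end F) g -> same_homology f g.
Proof.
move=> Ff Fg n a; have [m Em] : exists m, m + 1 = n by exists (n - 1); lia.
case: n / Em a => a za; apply/homologous_sym/(is_boundaryP (erefl _)).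
exists (F _ a).2; rewrite -Ff -Fg.
by have /(congr1 snd)/subr0_eq := hom_cycle F za erefl.
Qed.

Lemma path_dE n m (E : m + 1 = n) (a a' : B n) (s : B (n + 1)) (t : B (m + 1)) :
  dg_d B erefl s = a' - a - ecast i (B i) E t ->
  dg_d path_alg E (a, a', s) = (dg_d B E a, dg_d B E a', t).
Proof.
by case: n / E a a' s => a a' s ds; congr (_, _, _); rewrite /= ds subKr.
Qed.

Lemma is_cycle_path n (a a' : B n) (s : B (n + 1)) :
  is_cycle a -> is_cycle a' -> dg_d B erefl s = a' - a ->
  is_cycle ((a, a', s) : path_alg n).
Proof.
move=> za za' ds m E; rewrite (@path_dE _ _ _ _ _ _ 0) ?za ?za' //.
by case: n / E a a' s {za za'} ds => a a' s ->; rewrite subr0.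
Qed.

End Path.

(** * A cofibrant model of the derived quotient *)

Section Kill.
Variables (k : comPzRingType) (R : dgAlg k) (z : R 0).

(** Where this element is a boundary, [y] is a right inverse of [1 - b] in homology. *)
Definition right_inv_rel (B : dgAlg k) (b y : B 0) : B 0 :=
  y - gmul (addr0 0) b y - gone B.

Lemma hmap_right_inv_rel (B C : dgAlg k) (f : dgHom B C) b y :
  f 0 (right_inv_rel b y) = right_inv_rel (f 0 b) (f 0 y).
Proof. by rewrite !linearB hmap_mul hmap_one. Qed.

Lemma is_cycle_right_inv_rel (B : dgAlg k) (b y : B 0) :
  is_cycle b -> is_cycle y -> is_cycle (right_inv_rel b y).
Proof.
move=> zb zy; apply: is_cycleB (@is_cycle1 _ B).
by apply: is_cycleB => //; apply: is_cycleM.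
Qed.

(** First adjoin a cycle [y], then [u] with [d u = (1 - z) y - 1]. *)
Definition kill_base : dgAlg k := cell (addNr 1) (0 : R (-1)).
Definition kill_base_in : dgHom R kill_base := cell_in (addNr 1) (0 : R (-1)).
Definition kill_base_y : kill_base 0 := cell_gen (addNr 1) (0 : R (-1)).

Definition kill : dgAlg k :=
  cell (add0r 1) (right_inv_rel (kill_base_in 0 z) kill_base_y).
Definition kill_base_kill : dgHom kill_base kill :=
  cell_in (add0r 1) (right_inv_rel (kill_base_in 0 z) kill_base_y).
Definition kill_in : dgHom R kill := hcomp kill_base_kill kill_base_in.
Definition kill_y : kill 0 := kill_base_kill 0 kill_base_y.
Definition kill_u : kill 1 :=
  cell_gen (add0r 1) (right_inv_rel (kill_base_in 0 z) kill_base_y).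

Lemma is_cycle_kill_base_y : is_cycle kill_base_y.
Proof.
by apply: (@is_cycleP _ _ _ _ (addNr 1)); rewrite cell_d_gen linear0.
Qed.

Lemma is_cycle_kill_y : is_cycle kill_y.
Proof. exact: hom_cycle is_cycle_kill_base_y. Qed.

Lemma d_kill_u : dg_d kill (add0r 1) kill_u = right_inv_rel (kill_in 0 z) kill_y.
Proof. by rewrite [LHS]cell_d_gen [LHS]hmap_right_inv_rel. Qed.

Lemma kill_rec (B : dgAlg k) (f : dgHom R B) (y : B 0) (u : B 1) :
  is_cycle y -> dg_d B (add0r 1) u = right_inv_rel (f 0 z) y ->
  exists h : dgHom kill B,
    [/\ heq (hcomp h kill_in) f, h 0 kill_y = y & h 1 kill_u = u].
Proof.
move=> zy du.
have dy : dg_d B (addNr 1) y = f (-1) 0 by rewrite zy linear0.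
pose h1 : dgHom kill_base B := cell_rec dy.
have h1_in : heq (hcomp h1 kill_base_in) f := cell_rec_in dy.
have h1_y : h1 0 kill_base_y = y := cell_rec_gen dy.
have du1 : dg_d B (add0r 1) u
    = h1 0 (right_inv_rel (kill_base_in 0 z) kill_base_y).
  by rewrite hmap_right_inv_rel h1_y [h1 0 _]h1_in.
exists (cell_rec du1); split.
- move=> n a; rewrite -h1_in; exact: (cell_rec_in du1).
- rewrite -h1_y; exact: (cell_rec_in du1).
- exact: cell_rec_gen.
Qed.

Lemma kill_hom_ext (B : dgAlg k) (f g : dgHom kill B) :
  heq (hcomp f kill_in) (hcomp g kill_in) -> f 0 kill_y = g 0 kill_y ->
  f 1 kill_u = g 1 kill_u -> heq f g.
Proof. by move=> fg fgy fgu; apply: cell_hom_ext fgu; apply: cell_hom_ext. Qed.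

Lemma kill_cofibration : is_cycle z -> cofibration kill_in.
Proof.
move=> zz; apply: cofibration_comp; apply: cell_cofibration.
  exact: is_cycle0.
apply: is_cycle_right_inv_rel is_cycle_kill_base_y; exact: hom_cycle.
Qed.

(** If [b = d c] is the image of [z], then [1 - b] is homologous to [1], and [1]
serves as a right inverse up to [- c]. *)
Lemma kill_hom_exists (B : dgAlg k) (f : dgHom R B) :
  is_boundary (f 0 z) -> exists h : dgHom kill B, heq (hcomp h kill_in) f.
Proof.
move=> /(is_boundaryP (add0r 1))[c dc].
have [|h [hf _ _]] := @kill_rec B f (gone B) (- c) (@is_cycle1 _ B).
  by rewrite linearN -dc /right_inv_rel gmul1r addrAC subrr add0r.
by exists h.
Qed.

(** With [b = d c] the image of [z], left multiplication by [c] is a homotopy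
between left multiplication by [1 - b] and the identity.  It gives an explicit path
[(y, y', Y)], [(u, u', U)] between the two choices of the generators. *)
Lemma kill_hom_unique (B : dgAlg k) (f g : dgHom kill B) :
  heq (hcomp f kill_in) (hcomp g kill_in) ->
  is_boundary (f 0 (kill_in 0 z)) -> same_homology f g.
Proof.
move=> fg /(is_boundaryP (add0r 1))[c dc].
set b := f 0 _ in dc.
pose y := f 0 kill_y; pose y' := g 0 kill_y.
pose u := f 1 kill_u; pose u' := g 1 kill_u.
have du : dg_d B (add0r 1) u = right_inv_rel b y.
  by rewrite -hmap_d d_kill_u hmap_right_inv_rel.
have du' : dg_d B (add0r 1) u' = right_inv_rel b y'.
  rewrite -hmap_d d_kill_u hmap_right_inv_rel.
  by rewrite -[g 0 (kill_in 0 z)]fg.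
have zy : is_cycle y := hom_cycle f is_cycle_kill_y.
have zy' : is_cycle y' := hom_cycle g is_cycle_kill_y.
pose dy := y' - y; pose Y := (u' - u) + gmul (addr0 1) c dy.
have zdy : is_cycle dy by apply: is_cycleB.
have dY : dg_d B (add0r 1) Y = dy.
  rewrite linearD linearB du du' (d_mul_cycler (add0r 1) _ _ (addr0 0)) //.
  rewrite -dc gmulBr /right_inv_rel.
  rewrite !(opprD, opprK) !addrA.
  by rewrite [LHS](ACl (1*4*6*3*7*2*5*8)) /= !addrK.
(* In the path algebra the boundary of [(u, u', U)] is to have the third
   component [Y - b Y]. *)
pose U := gmul (erefl : 1 + 1 = 1 + 1) c Y.
have dU : dg_d B erefl U = (u' - u) - (Y - gmul (add0r 1) b Y).
  rewrite (dg_leibniz (add0r 1) (add0r 1) _ _ (add0r 1) (addr0 1)) -dc dY.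
  by rewrite koszul1 scaleN1r opprB /Y addrCA opprD addNKr.
pose F0 := hcomp (path_const B) (hcomp f kill_in).
have [||F [F1 F2 F3]] := @kill_rec (path_alg B) F0 (y, y', Y) (u, u', U).
- apply: is_cycle_path => //; rewrite -[RHS]dY.
  by congr (dg_d B _ _); apply: eq_irrelevance.
- have Frel : right_inv_rel (F0 0 z) (y, y', Y)
      = (right_inv_rel b y, right_inv_rel b y', Y - gmul (add0r 1) b Y).
    congr (_, _, _); rewrite /= gmul0l [LHS]subr0 [X in _ - X]add0r scale1r.
    congr (_ - _).
    by congr (gmul _ _ _); apply: eq_irrelevance.
  rewrite Frel (@path_dE _ B 1 0 _ _ _ _ (Y - gmul (add0r 1) b Y)) ?du ?du' //.
  have EW (W : B 1) : ecast i (B i) (add0r 1) (W : B (0 + 1)) = W.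
    by rewrite (eq_irrelevance (add0r 1) (@erefl int 1)).
  rewrite EW; exact: dU.
apply: (@homotopic_same_homology _ _ _ F).
- apply: kill_hom_ext.
  + by move=> n a; rewrite /= [F n _]F1.
  + by rewrite /= F2.
  + by rewrite /= F3.
- apply: kill_hom_ext.
  + move=> n a; rewrite /= [F n _]F1 /=; exact: fg.
  + by rewrite /= F2.
  + by rewrite /= F3.
Qed.

(** Multiply the homotopy from [(1 - z) y] to [1] by [z] and use that [z (1 - z)] is
a boundary. *)
Lemma kill_in_boundary (w : R 1) : is_cycle z ->
  z - gmul (addr0 0) z z = dg_d R (add0r 1) w -> is_boundary (kill_in 0 z).
Proof.
move=> zz dw; pose b := kill_in 0 z; pose W := kill_in 1 w.
have zb : is_cycle b by apply: hom_cycle.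
have dW : dg_d kill (add0r 1) W = b - gmul (addr0 0) b b.
  by rewrite -hmap_d -dw linearB hmap_mul.
have -> : kill_in 0 z = dg_d kill (add0r 1)
    (gmul (addr0 1) W kill_y - gmul (add0r 1) b kill_u); last first.
  exact: is_boundary_d.
rewrite linearB (d_mul_cycler (add0r 1) _ _ (addr0 0)); last first.
  exact: is_cycle_kill_y.
rewrite (d_mul_cyclel (add0r 1) _ _ (addr0 0)) // scale1r dW d_kill_u.
rewrite gmulBl !gmulBr gmul1r (gmulA _ _ (addr0 0) (addr0 0)).
by rewrite opprB addrC subrK.
Qed.

End Kill.

Lemma kill_pushout (k : comPzRingType) (R S : dgAlg k) (p : dgHom R S) (z : R 0) :
  exists r : dgHom (kill z) (kill (p 0 z)),
    is_pushout p (kill_in z) (kill_in (p 0 z)) r.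
Proof.
have [|r [r_in ry ru]] := @kill_rec _ _ z _ (hcomp (kill_in (p 0 z)) p) _
  (kill_u (p 0 z)) (is_cycle_kill_y (p 0 z)).
  exact: d_kill_u.
exists r; split=> [n a|C f g fg]; first by rewrite r_in.
have zgy : is_cycle (g 0 (kill_y z)) by apply/hom_cycle/is_cycle_kill_y.
have [|h [h_in hy hu]] := @kill_rec _ _ (p 0 z) _ f _ (g 1 (kill_u z)) zgy.
  by rewrite -hmap_d d_kill_u hmap_right_inv_rel [f 0 _]fg.
exists h; split=> //.
  apply: kill_hom_ext => [n a||].
  - by rewrite -fg -[RHS]h_in; congr (h n _); apply: r_in.
  - by rewrite /= ry.
  - by rewrite /= ru.
move=> h' h'_in h'r; apply: kill_hom_ext => [n a||].
- by rewrite [LHS]h'_in h_in.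
- by rewrite hy -h'r /= ry.
- by rewrite hu -h'r /= ru.
Qed.

(** * Adjoining a strict nullhomotopy of the idempotent *)

Section Adj.
Variables (k : comPzRingType) (A : dgAlg k) (e : A 0).
Hypothesis (de : is_cycle e).
Hypothesis (ee : strict_idempotent e).

Local Notation Ae := (adj_dg de ee).

HB.instance Definition _ n :=
  GRing.isLinear.Build k (A n) (Ae n) _ (@adj_in k A e n)
    (fun r a b =>
      etrans (adj_inD e (r *: a) b) (congr1 (+%R^~ _) (adj_inZ e r a))).

Definition adj_incl : dgHom A Ae :=
  @DGHom k A Ae (fun n => @adj_in k A e n : {linear A n -> Ae n})
    (fun n m E a => esym (adj_dg_in de ee E a)) (@adj_inM k A e) erefl.

Lemma adj_he : gmul (addr0 1) (adj_h e : Ae 1) (adj_incl 0 e) = adj_h e.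
Proof. by rewrite [LHS]/= -adj_cls_mul; apply/adj_clsE/ae_he. Qed.

Lemma adj_eh : gmul (add0r 1) (adj_incl 0 e) (adj_h e : Ae 1) = adj_h e.
Proof. by rewrite [LHS]/= -adj_cls_mul; apply/adj_clsE/ae_eh. Qed.

Lemma adj_hom_ext (B : dgAlg k) (f g : dgHom Ae B) :
  heq (hcomp f adj_incl) (hcomp g adj_incl) ->
  f 1 (adj_h e) = g 1 (adj_h e) -> heq f g.
Proof.
move=> fg fgh n; elim/adj_ind.
elim=> {n} [n a||n t IHt u IHu|n r t IHt|i j l E t IHt u IHu].
- exact: fg.
- exact: fgh.
- by rewrite adj_cls_add !linearD IHt IHu.
- by rewrite adj_cls_scale !linearZ IHt.
- by rewrite adj_cls_mul !(@hmap_mul _ Ae) IHt IHu.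
Qed.

Section Rec.
Variables (B : dgAlg k) (f : dgHom A B) (h : B 1).
Hypothesis dh : dg_d B (add0r 1) h = f 0 e.
Hypothesis he : gmul (addr0 1) h (f 0 e) = h.
Hypothesis eh : gmul (add0r 1) (f 0 e) h = h.

Fixpoint adj_eval n (t : adj_term A n) : B n :=
  match t in adj_term _ n return B n with
  | At_in n a => f n a
  | At_h => h
  | At_add _ t u => adj_eval t + adj_eval u
  | At_scale _ r t => r *: adj_eval t
  | At_mul _ _ _ E t u => gmul E (adj_eval t) (adj_eval u)
  end.

Lemma adj_eval_eq n (t u : adj_term A n) : adj_eq e t u ->
  adj_eval t = adj_eval u.
Proof.
elim=> {n t u} /=.
- by [].
- by [].
- by move=> n t u v _ -> _ ->.
- by move=> n t t' u u' _ -> _ ->.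
- by move=> n r t t' _ ->.
- by move=> i j l E t t' u u' _ -> _ ->.
- by move=> *; rewrite addrA.
- by move=> *; rewrite addrC.
- by move=> *; rewrite linear0 add0r.
- by move=> *; rewrite linear0 scaleN1r addNr.
- by move=> *; rewrite scalerA.
- by move=> *; rewrite scale1r.
- by move=> *; rewrite scalerDr.
- by move=> *; rewrite scalerDl.
- by move=> *; rewrite gmulDl.
- by move=> *; rewrite gmulDr.
- by move=> *; rewrite gmulZl.
- by move=> *; rewrite gmulZr.
- by move=> *; apply: gmulA.
- by move=> *; rewrite hmap_one gmul1l.
- by move=> *; rewrite hmap_one gmul1r.
- by move=> *; rewrite linearD.
- by move=> *; rewrite linearZ.
- by move=> *; rewrite hmap_mul.
- by move=> E; rewrite (eq_irrelevance E (addr0 1)).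
- by move=> E; rewrite (eq_irrelevance E (add0r 1)).
Qed.

Definition adj_rec_fun n (x : Ae n) : B n := adj_eval (repr (x : adj e n)).

Lemma adj_rec_cls n (t : adj_term A n) : adj_rec_fun (adj_cls e t) = adj_eval t.
Proof. exact/adj_eval_eq/adj_reprE. Qed.

Lemma adj_rec_linear n : linear (@adj_rec_fun n).
Proof.
move=> r; elim/adj_ind=> t; elim/adj_ind=> u.
by rewrite -adj_cls_scale -adj_cls_add !adj_rec_cls.
Qed.

HB.instance Definition _ n :=
  GRing.isLinear.Build k (Ae n) (B n) _ (@adj_rec_fun n) (@adj_rec_linear n).

Lemma adj_rec_mul i j l (E : i + j = l) (x : Ae i) (y : Ae j) :
  adj_rec_fun (gmul E x y) = gmul E (adj_rec_fun x) (adj_rec_fun y).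
Proof.
elim/adj_ind: x => t; elim/adj_ind: y => u.
by rewrite [gmul E _ _]/= -adj_cls_mul !adj_rec_cls.
Qed.

Lemma adj_rec_d n m (E : m + 1 = n) (x : Ae n) :
  adj_rec_fun (dg_d Ae E x) = dg_d B E (adj_rec_fun x).
Proof.
elim/adj_ind: x => t; rewrite [dg_d Ae _ _](adj_d_cls de ee) adj_rec_cls.
elim: t m E => {n} [n a||n t IHt u IHu|n r t IHt|i j l D t IHt u IHu] m E.
- by rewrite adj_rec_cls /= hmap_d.
- have Em : m = 0 by lia.
  subst m; rewrite /= (eq_irrelevance (deg_h E) erefl) adj_rec_cls /= -dh.
  by congr (dg_d B _ _); apply: eq_irrelevance.
- by rewrite /= !linearD; congr (_ + _); [apply: IHt | apply: IHu].
- by rewrite /= !linearZ; congr (_ *: _); apply: IHt.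
- have G1 : (i - 1) + j = m by lia.
  have G2 : i + (j - 1) = m by lia.
  rewrite (adj_dt_mul _ D (subrK 1 i) (subrK 1 j) E G1 G2) /=.
  rewrite (dg_leibniz (subrK 1 i) (subrK 1 j) E D G1 G2).
  rewrite linearD; congr (_ + _); last rewrite linearZ; [|congr (_ *: _)].
    by rewrite [LHS]adj_rec_mul IHt adj_rec_cls.
  by rewrite [LHS]adj_rec_mul IHu adj_rec_cls.
Qed.

Lemma adj_rec : exists g : dgHom Ae B,
  heq (hcomp g adj_incl) f /\ g 1 (adj_h e) = h.
Proof.
have rec1 : adj_rec_fun (gone Ae) = gone B by rewrite adj_rec_cls /= hmap_one.
exists (@DGHom k Ae B (fun n => @adj_rec_fun n : {linear Ae n -> B n})
  adj_rec_d adj_rec_mul rec1); split; last exact: adj_rec_cls.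
by move=> n a; apply: adj_rec_cls.
Qed.

End Rec.

Lemma adj_boundary : is_boundary (adj_incl 0 e).
Proof.
by rewrite -[adj_incl 0 e](adj_dg_h de ee (add0r 1)); apply: is_boundary_d.
Qed.

(** If [d c = e], then also [d (e c e) = e], and [e c e] satisfies the relations. *)
Lemma adj_hom_exists (B : dgAlg k) (f : dgHom A B) :
  is_boundary (f 0 e) -> exists g : dgHom Ae B, heq (hcomp g adj_incl) f.
Proof.
move=> /(is_boundaryP (add0r 1))[c dc].
have bb : gmul (addr0 0) (f 0 e) (f 0 e) = f 0 e by rewrite -hmap_mul ee.
have zb : is_cycle (f 0 e) by apply: hom_cycle.
pose ec := gmul (add0r 1) (f 0 e) c.
have [|||g [gf _]] := @adj_rec B f (gmul (addr0 1) ec (f 0 e)).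
- rewrite (d_mul_cycler (add0r 1) _ _ (addr0 0)) //.
  by rewrite (d_mul_cyclel (add0r 1) _ _ (addr0 0)) // scale1r -dc !bb.
- by rewrite (gmulA _ _ (addr0 0) (addr0 1)) bb.
- rewrite -(gmulA (add0r 1) (addr0 1)); congr (gmul _ _ _).
  by rewrite -(gmulA (addr0 0) (add0r 1)) bb.
by exists g.
Qed.

(** Two choices [h] and [h'] of the generator differ by a cycle of [eBe], which is
the boundary of its product with [h]. *)
Lemma adj_hom_unique (B : dgAlg k) (f g : dgHom Ae B) :
  heq (hcomp f adj_incl) (hcomp g adj_incl) -> same_homology f g.
Proof.
move=> fg; pose b := f 0 (adj_incl 0 e).
have gb : g 0 (adj_incl 0 e) = b by rewrite -[LHS]fg.
pose h := f 1 (adj_h e); pose h' := g 1 (adj_h e).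
have he : gmul (addr0 1) h b = h by rewrite -hmap_mul adj_he.
have eh : gmul (add0r 1) b h = h by rewrite -hmap_mul adj_eh.
have he' : gmul (addr0 1) h' b = h' by rewrite -gb -hmap_mul adj_he.
have eh' : gmul (add0r 1) b h' = h' by rewrite -gb -hmap_mul adj_eh.
have dh : dg_d B (add0r 1) h = b by rewrite -hmap_d adj_dg_h.
have dh' : dg_d B (add0r 1) h' = b by rewrite -hmap_d adj_dg_h.
pose H := gmul (erefl : 1 + 1 = 1 + 1) h (h' - h).
have dH : dg_d B erefl H = h' - h.
  rewrite (d_mul_cycler (add0r 1) _ _ (add0r 1)); last first.
    by apply: (@is_cycleP _ _ _ _ (add0r 1)); rewrite linearB dh dh' subrr.
  by rewrite dh gmulBr eh eh'.
pose F0 := hcomp (path_const B) (hcomp f adj_incl).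
have [|||F [F1 F2]] := @adj_rec (path_alg B) F0 (h, h', H).
- rewrite (@path_dE _ B 1 0 _ _ _ _ 0) ?dh ?dh' //.
  have -> : ecast i (B i) (add0r 1) (0 : B (0 + 1)) = 0.
    by rewrite (eq_irrelevance (add0r 1) (@erefl int 1)).
  by rewrite subr0.
- congr (_, _, _) => //=.
  rewrite gmul0r scaler0 addr0 (gmulA _ _ (addr0 1) erefl) gmulBl.
  by rewrite -!/b he he'.
- congr (_, _, _) => //=.
  rewrite gmul0l scale1r [LHS]add0r -(gmulA (add0r 1) erefl) -/b.
  by rewrite eh.
apply: (@homotopic_same_homology _ _ _ F); apply: adj_hom_ext.
- by move=> n a; rewrite /= [F n _]F1.
- by rewrite /= F2.
- by move=> n a; rewrite /= [F n _]F1 /=; exact: fg.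
- by rewrite /= F2.
Qed.

End Adj.

(** * Zigzags act on homology *)

Section Zigzag.
Variables (k : comPzRingType) (Q : dgAlg k).
Implicit Types X Y Z : underAlg Q.

(** The action of a zigzag on homology, as a relation between representatives: a
backward quasi-isomorphism is inverted. *)
Fixpoint zz_rel X Y (p : zigzag X Y) n : X n -> Y n -> Prop :=
  match p in zigzag X Y return X n -> Y n -> Prop with
  | zz_nil X => fun a b => homologous a b
  | zz_fwd _ _ _ f p => fun a b => zz_rel p (f n a) b
  | zz_bwd _ _ _ w _ p => fun a b =>
      exists a', [/\ is_cycle a', homologous (w n a') a & zz_rel p a' b]
  end.

Lemma zz_rel_homologous X Y (p : zigzag X Y) n (a a' : X n) b :
  is_cycle a -> is_cycle a' -> homologous a a' -> zz_rel p a b -> zz_rel p a' b.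
Proof.
elim: p a a' b => {X Y} [X|X Y Z f p IH|X Y Z w qw p IH] /= a a' b za za' aa'.
- exact/homologous_trans/homologous_sym.
- by apply: IH; [apply: hom_cycle|apply: hom_cycle|apply: hom_homologous].
- move=> [c [zc wca cb]]; exists c; split=> //; exact: homologous_trans aa'.
Qed.

Lemma zz_rel_functional X Y (p : zigzag X Y) n (a : X n) b b' :
  is_cycle a -> zz_rel p a b -> zz_rel p a b' -> homologous b b'.
Proof.
elim: p a b b' => {X Y} [X|X Y Z f p IH|X Y Z w qw p IH] /= a b b' za.
- by move=> /homologous_sym ab; apply: homologous_trans ab.
- by apply: IH; apply: hom_cycle.
- move=> [c [zc wca cb]] [c' [zc' wca' cb']]; apply: (IH c') => //.
  apply: zz_rel_homologous cb => //; have [inj _] := qw n.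
  apply: inj => //; apply: homologous_trans wca _; exact: homologous_sym.
Qed.

Lemma zz_rel_total X Y (p : zigzag X Y) n (a : X n) :
  is_cycle a -> exists2 b, is_cycle b & zz_rel p a b.
Proof.
elim: p a => {X Y} [X|X Y Z f p IH|X Y Z w qw p IH] /= a za.
- by exists a => //; apply: homologous_refl.
- by apply: IH; apply: hom_cycle.
- have [_ /(_ a za)[c zc wca]] := qw n; have [b zb cb] := IH c zc.
  by exists b => //; exists c.
Qed.

Lemma zz_eq_rel X Y (p p' : zigzag X Y) : zz_eq p p' ->
  forall n (a : X n) b, is_cycle a -> zz_rel p a b <-> zz_rel p' a b.
Proof.
elim=> {X Y p p'} //=.
- by move=> X Y p p' _ IH n a b za; split=> /(IH n a b za).
- by move=> X Y p q r _ IH1 _ IH2 n a b za; rewrite IH1 // IH2.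
- by move=> X Y Z f p p' _ IH n a b za; apply: IH; apply: hom_cycle.
- move=> X Y Z w qw p p' _ IH n a b za.
  by split=> -[c [zc wca cb]]; exists c; split=> //; apply/IH.
- by move=> X Y f p fid n a b za; rewrite fid.
- by move=> X Y Z T f g h p hgf n a b za; rewrite hgf.
- move=> X Y Z w qw p n a b za; split=> [[c [zc wca cb]]|ab].
    apply: zz_rel_homologous cb => //; have [inj _] := qw n; exact: inj.
  by exists a; split=> //; apply: homologous_refl.
- move=> X Y Z w qw p n a b za; split=> [[c [zc wca cb]]|ab].
    by apply: zz_rel_homologous cb => //; apply: hom_cycle.
  have [_ /(_ a za)[c zc wca]] := qw n; exists c; split=> //.
  apply: zz_rel_homologous ab => //; first exact: hom_cycle.
  exact: homologous_sym.
Qed.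

Fixpoint zz_rcons X Y Z (p : zigzag X Y) : underHom Y Z -> zigzag X Z :=
  match p in zigzag X Y return underHom Y Z -> zigzag X Z with
  | zz_nil X => fun f => zz_fwd f (zz_nil Z)
  | zz_fwd _ _ _ g p => fun f => zz_fwd g (zz_rcons p f)
  | zz_bwd _ _ _ w qw p => fun f => zz_bwd qw (zz_rcons p f)
  end.

Lemma zz_rel_rcons X Y Z (p : zigzag X Y) (f : underHom Y Z) n (a : X n) b :
  zz_rel p a b -> zz_rel (zz_rcons p f) a (f n b).
Proof.
elim: p f a b => {X Y} [X|X Y W g p IH|X Y W w qw p IH] f a b /=.
- exact: hom_homologous.
- exact: IH.
- by move=> [c [zc wca cb]]; exists c; split=> //; apply: IH.
Qed.

End Zigzag.

(** * The derived quotient *)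

Section DerivedQuotient.
Variables (k : comPzRingType) (Q : dgAlg k) (z : Q 0).
Hypothesis zz : is_cycle z.

Let X : underAlg Q := Under (kill_in z).
Implicit Types Y Z : underAlg Q.

(** The maps out of [kill z] are carried to each other by every zigzag: at a backward
step, the map to the source of the quasi-isomorphism exists because [z] is
also a boundary there, and uniqueness makes the triangle commute on homology. *)
Lemma zz_rel_kill Y Z (p : zigzag Y Z) (f : underHom X Y) (g : underHom X Z) :
  is_boundary (ua_map Y 0 z) ->
  forall n (x : kill z n), is_cycle x -> zz_rel p (f n x) (g n x).
Proof.
have uniq (W : underAlg Q) (f1 f2 : underHom X W) :
    is_boundary (ua_map W 0 z) -> same_homology f1 f2.
  move=> bW; apply: kill_hom_unique.
    by move=> n a; rewrite [LHS](under_homE f1) [RHS](under_homE f2).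
  by rewrite [f1 0 _](under_homE f1).
elim: p f g => {Y Z} [Y|Y W Z h p IH|Y W Z w qw p IH] f g bY n x zx /=.
- exact: uniq.
- have hf : heq (hcomp (hcomp h f) (ua_map X)) (ua_map W).
    by move=> m a; rewrite -(under_homE h); congr (h m _); apply: (under_homE f).
  apply: (IH (UnderHom hf)) => //; rewrite -(under_homE h).
  exact: (hom_boundary h bY).
- have bW : is_boundary (ua_map W 0 z).
    apply: (quasi_iso_boundary qw); first exact: hom_cycle.
    by rewrite [w 0 _](under_homE w).
  have [f' f'E] := kill_hom_exists bW.
  pose f'u : underHom X W := @UnderHom _ _ X W f' f'E.
  have wf' : heq (hcomp (hcomp w f'u) (ua_map X)) (ua_map Y).
    by move=> m a; rewrite -(under_homE w); congr (w m _); apply: f'E.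
  exists (f' n x); split; first exact: hom_cycle.
    exact: (uniq _ (UnderHom wf') f).
  exact: (IH f'u g).
Qed.

(** Initiality of [D] gives a zigzag from [D] to [kill z].  Followed by [f] it is the
identity of [D], since [D] has only one endomorphism; in the other order
[zz_rel_kill] applies. *)
Lemma kill_derived_quotient (A : dgAlg k) (q : dgHom Q A) (e : A 0)
    (D : underAlg Q) (f : dgHom (kill z) D) :
  quasi_iso q -> homologous (q 0 z) e -> is_boundary (kill_in z 0 z) ->
  heq (hcomp f (kill_in z)) (ua_map D) -> is_derived_quotient q e D ->
  quasi_iso f.
Proof.
move=> qq qz bz fE [kD initD]; pose fu : underHom X D := @UnderHom _ _ X D f fE.
have kX : killing q e X.
  move=> z' zz' qz'; rewrite /=.
  have zz'z : homologous z' z.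
    have [inj _] := qq 0; apply: inj => //.
    exact: homologous_trans (homologous_sym qz).
  exact: is_boundary_homologous (hom_homologous _ zz'z) bz.
have [p _] := initD X kX.
have pf_id n (d : D n) b : is_cycle d ->
    zz_rel (zz_rcons p fu) d b <-> homologous d b.
  have [r r_uniq] := initD D kD; apply: (zz_eq_rel (p' := zz_nil D)).
  exact: zz_trans (r_uniq _) (zz_sym (r_uniq _)).
have idu : heq (hcomp (hid X) (ua_map X)) (ua_map X) by [].
have pf n (x : kill z n) : is_cycle x -> zz_rel p (f n x) x.
  apply: (@zz_rel_kill _ _ p fu (UnderHom idu)); exact: kD.
move=> n; split=> [x x' zx zx' ff|d zd].
  apply: (@zz_rel_functional _ _ _ _ p _ (f n x')); [exact: hom_cycle| |exact: pf].
  by apply: zz_rel_homologous ff (pf _ _ zx); apply: hom_cycle.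
have [x zx dx] := zz_rel_total p zd; exists x => //.
by apply/homologous_sym/pf_id => //; apply: (zz_rel_rcons fu).
Qed.

End DerivedQuotient.

(** A surjective quasi-isomorphism lifts the cycle [e] itself, but the equation
[e e = e] only up to a boundary, which is what [kill_in_boundary] asks for. *)
Lemma lift_idempotent (k : comPzRingType) (A Q : dgAlg k) (q : dgHom Q A)
    (e : A 0) :
  fibration q -> quasi_iso q -> is_cycle e -> strict_idempotent e ->
  exists z : Q 0, [/\ q 0 z = e, is_cycle z & is_boundary (kill_in z 0 z)].
Proof.
move=> fq qq de ee.
have [z [qz dz]] : exists z : Q 0, q 0 z = e /\ dg_d Q (addNr 1) z = 0.
  apply: acyclic_fibration_lift; rewrite ?de ?linear0 //; exact: is_cycle0.
have zz : is_cycle z by apply: is_cycleP dz.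
have : homologous (gmul (addr0 0) z z) z.
  have [inj _] := qq 0; apply: inj => //; first exact: is_cycleM.
  by rewrite hmap_mul qz ee; apply: homologous_refl.
move=> /homologous_sym/(is_boundaryP (add0r 1))[w dw].
by exists z; split=> //; apply: kill_in_boundary dw.
Qed.

(** Both algebras map to each other under [A].  One composite is controlled by
uniqueness of maps out of [adj_dg], the other by uniqueness of maps out of
[kill z], whose homology is that of [kill (q 0 z)]. *)
Lemma adj_kill_quasi_iso (k : comPzRingType) (A Q : dgAlg k) (q : dgHom Q A)
    (z : Q 0) (de : is_cycle (q 0 z)) (ee : strict_idempotent (q 0 z))
    (r : dgHom (kill z) (kill (q 0 z))) :
  is_boundary (kill_in z 0 z) ->
  heq (hcomp (kill_in (q 0 z)) q) (hcomp r (kill_in z)) -> quasi_iso r ->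
  exists f : dgHom (adj_dg de ee) (kill (q 0 z)), quasi_iso f.
Proof.
move=> bz rE qr.
have be : is_boundary (kill_in (q 0 z) 0 (q 0 z)).
  by have := hom_boundary r bz; rewrite -[r 0 _](rE 0 z).
have [f fE] := adj_hom_exists de ee be.
have [g gE] := kill_hom_exists (adj_boundary de ee).
exists f; apply: (quasi_iso_inverse (g := g)).
  apply: adj_hom_unique => n a; rewrite -[RHS]gE; congr (g n _); exact: fE.
have fgrE :
    heq (hcomp (hcomp (hcomp f g) r) (kill_in z)) (hcomp r (kill_in z)).
  move=> n a; have rn : r n (kill_in z n a) = kill_in (q 0 z) n (q n a).
    exact: esym (rE n a).
  rewrite -[LHS]/(f n (g n (r n (kill_in z n a)))).
  rewrite -[RHS]/(r n (kill_in z n a)) rn -[RHS]fE; congr (f n _).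
  exact: gE.
have fgr := kill_hom_unique fgrE (hom_boundary (hcomp (hcomp f g) r) bz).
move=> n a za; have [_ /(_ a za)[x zx xa]] := qr n.
apply: homologous_trans (homologous_trans _ xa).
  exact: homologous_sym (hom_homologous (hcomp f g) xa).
exact: fgr zx.
Qed.

Theorem proposition9p6 (k : comPzRingType) (A : dgAlg k) (hA : left_proper A)
    (e : A 0) (de : is_cycle e) (ee : strict_idempotent e)
    (Q : dgAlg k) (q : dgHom Q A) (hq : cofibrant_replacement q)
    (D : underAlg Q) (hD : is_derived_quotient q e D) :
  quasi_isomorphic (adj_dg de ee) D.
Proof.
have [_ fq qq] := hq.
have [z [qz zz bz]] := lift_idempotent fq qq de ee.
subst e.
have [f fE] : exists f : dgHom (kill z) D, heq (hcomp f (kill_in z)) (ua_map D).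
  by apply: kill_hom_exists; apply: hD.1 => //; apply: homologous_refl.
have qf : quasi_iso f.
  by apply: kill_derived_quotient hD => //; apply: homologous_refl.
have [r po] := kill_pushout q z.
have qr : quasi_iso r by apply: hA po => //; apply: kill_cofibration.
have [g qg] := adj_kill_quasi_iso de ee bz po.1 qr.
apply: qi_trans (qi_step qg) _; apply: qi_trans (qi_step qf).
exact/qi_sym/qi_step/qr.
Qed.
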